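(* Let $l\ge 3$ and let $AdS_l=G/H$ be the $l$-dimensional anti de Sitter space, with $G=\mathrm{SO}_0(2,l-1)$ and $H=\mathrm{SO}_0(1,l-1)$. Declare singular the closed orbits in $AdS_l$ of the Iwasawa subgroup $R=AN$ of $G$ and of its Cartan conjugate $\overline R=A\overline N$, and let $\mathscr S$ be the union of these closed orbits. Then $AdS_l$ is a causal solvable symmetric black hole, i.e. $\mathscr S$ is non-empty and both inclusions $$\mathscr S\subset BH\subset AdS_l$$ are strict, where $BH$ is the set of interior points (the black hole) determined by $\mathscr S$. In particular the event horizon is non-empty. Moreover, there are only finitely many such closed orbits.
   Context: Elements of $\mathrm{SO}(2,l-1)$ are real $(l+1)\times(l+1)$ matrices of determinant $1$ preserving $\eta=\mathrm{diag}(-1,-1,1,\dots,1)$; coordinates on $\mathbb R^{2,l-1}$ are $(u,t,x,y,x_3,\dots,x_{l-1})$. $\mathrm{SO}(1,l-1)$ is the subgroup fixing $(1,0,\dots,0)$; index $0$ denotes the identity component. $\mathfrak g,\mathfrak h$ are the Lie algebras of $G,H$; $E_{ij}$ are elementary matrices. $AdS_l=G/H$ is identified with the hyperboloid $u^2+t^2-x^2-y^2-x_3^2-\dots-x_{l-1}^2=1$ by $[g]\mapsto g\cdot(1,0,\dots,0)^T$; $\pi:G\to G/H$ is the projection. Let $\mathfrak q$ be the Killing-orthogonal complement of $\mathfrak h$; it has basis $q_0=E_{12}-E_{21}$, $q_i=E_{1,i+2}+E_{i+2,1}$ ($1\le i\le l-1$). The metric on $AdS_l$ is the $G$-invariant one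 induced from the Killing form restricted to $\mathfrak q$ (with sign such that $q_0$ has positive norm, i.e. is time-like, and the $q_i$ have negative norm); light-like means of zero norm. Time is oriented by $q_0$. Put $K_H=\mathrm{SO}(l-1)$, the subgroup of matrices $\mathrm{diag}(1,1,k)$, and $E_1=q_0+q_1$. The future-directed light-like geodesics starting at $[g]$ are (up to positive affine reparametrisation) $s\mapsto l^k_{[g]}(s)=\pi(g\,e^{s\,\mathrm{Ad}(k)E_1})$, $s\ge 0$, $k\in K_H$. Iwasawa subgroup: the Cartan involution is $\theta(X)=-X^T$; $\mathfrak a=\mathrm{span}\{J_1,J_2\}$ with $J_1=E_{24}+E_{42}$, $J_2=E_{13}+E_{31}$; $\mathfrak n=\mathrm{span}\{W_i,V_i,M,L: 5\le i\le l+1\}$ with $W_i=E_{2i}+E_{4i}+E_{i2}-E_{i4}$, $V_i=E_{1i}+E_{3i}+E_{i1}-E_{i3}$, and $M,L$ zero except for the upper-left $4\times4$ blocks $$M=\begin{pmatrix}0&1&0&-1\\-1&0&1&0\\0&1&0&-1\\-1&0&1&0\end{pmatrix},\quad L=\begin{pmatrix}0&1&0&-1\\-1&0&-1&0\\0&-1&0&1\\-1&0&-1&0\end{pmatrix}.$$ $A=\exp\mathfrak a$, $N=\exp\mathfrak n$, $\overline N=\exp\theta(\mathfrak n)$. These groups act on $G/H$ from the left. A point $p\in AdS_l$ is interior (belongs to $BH$) if every future-directed light-like geodesic starting at $p$ meets $\mathscr S$ at some finite parameter $s\ge 0$. A point which is not interior is exterior. The event horizon is the topological boundary of $BH$. A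 causal solvable symmetric black hole is a causal symmetric space in which the closed orbits of the minimal parabolic (Iwasawa) subgroups of the isometry group define a black hole singularity in this non-trivial sense. *)

(* Defs.v *)
From HB Require Import structures.
From mathcomp Require Import all_boot all_order all_algebra.
From mathcomp Require Import all_classical all_reals all_analysis.

Import Order.TTheory GRing.Theory Num.Theory.
Import numFieldTopology.Exports.

Local Open Scope classical_set_scope.
Local Open Scope ring_scope.

(* R^{2,l-1} is 'cV[R]_(2 + l.-1), with coordinates (u, t | x, y, x_3, ...),
   so that the l + 1 coordinates are split according to the signature. *)

(* The limit is entrywise. *)
Definition expmx {R : realType} {n : nat} (X : 'M[R]_n) : 'M[R]_n :=
  lim (series (fun k : nat => (k`!%:R)^-1 *: X ^+ k) @ \oo).

Definition eta_mx (R : realType) (p q : nat) : 'M[R]_(p + q) :=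
  block_mx (- 1%:M) 0 0 1%:M.

Definition SO (R : realType) (p q : nat) : set 'M[R]_(p + q) :=
  [set g | \det g = 1 /\ g^T *m eta_mx R p q *m g = eta_mx R p q].

Definition SO0 (R : realType) (p q : nat) : set 'M[R]_(p + q) :=
  connected_component (SO R p q) 1%:M.

Definition groupG (R : realType) (l : nat) : set 'M[R]_(2 + l.-1) :=
  SO0 R 2 l.-1.

(* G/H is realised as the hyperboloid: H = SO_0(1,l-1) is the stabiliser in G
   of the base point e_1, and the class [g] is the point g e_1. *)
Definition AdS (R : realType) (l : nat) : set 'cV[R]_(2 + l.-1) :=
  [set p | \sum_(i < 2) p (lshift l.-1 i) 0 ^+ 2
           - \sum_(j < l.-1) p (rshift 2 j) 0 ^+ 2 = 1].

Definition proj_AdS {R : realType} {l : nat} (g : 'M[R]_(2 + l.-1)) :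
  'cV[R]_(2 + l.-1) := g *m delta_mx (lshift l.-1 ord0) 0.

(* Elementary matrices, with indices starting from 1. *)
Definition Emx (R : realType) (l i j : nat) : 'M[R]_(2 + l.-1) :=
  \matrix_(a, b) ((a.+1 == i) && (b.+1 == j))%:R.

Definition q0 (R : realType) (l : nat) : 'M[R]_(2 + l.-1) :=
  Emx R l 1 2 - Emx R l 2 1.

Definition q (R : realType) (l i : nat) : 'M[R]_(2 + l.-1) :=
  Emx R l 1 i.+2 + Emx R l i.+2 1.

Definition E1 (R : realType) (l : nat) : 'M[R]_(2 + l.-1) := q0 R l + q R l 1.

Definition KH (R : realType) (l : nat) : set 'M[R]_(2 + l.-1) :=
  [set block_mx 1%:M 0 0 k | k in
     [set k : 'M[R]_l.-1 | \det k = 1 /\ k^T *m k = 1%:M]].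

Definition Ad {R : realType} {n : nat} (g X : 'M[R]_n) : 'M[R]_n :=
  g *m X *m invmx g.

(* The future-directed light-like geodesics starting at p = [g], given up to
   positive affine reparametrisation. *)
Definition future_lightlike_geodesic {R : realType} {l : nat}
    (p : 'cV[R]_(2 + l.-1)) : set (R -> 'cV[R]_(2 + l.-1)) :=
  [set gamma | exists g k : 'M[R]_(2 + l.-1),
     [/\ groupG R l g, KH R l k, proj_AdS g = p &
         gamma = fun s : R => proj_AdS (g *m expmx (s *: Ad k (E1 R l)))]].

(* The matrix with the given rows in its upper-left corner, zero elsewhere. *)
Definition upper_left {R : realType} (l : nat) (rows : seq (seq R)) :
  'M[R]_(2 + l.-1) := \matrix_(a, b) nth 0 (nth [::] rows a) b.

Definition J1 (R : realType) (l : nat) : 'M[R]_(2 + l.-1) :=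
  Emx R l 2 4 + Emx R l 4 2.

Definition J2 (R : realType) (l : nat) : 'M[R]_(2 + l.-1) :=
  Emx R l 1 3 + Emx R l 3 1.

Definition W (R : realType) (l i : nat) : 'M[R]_(2 + l.-1) :=
  Emx R l 2 i + Emx R l 4 i + Emx R l i 2 - Emx R l i 4.

Definition V (R : realType) (l i : nat) : 'M[R]_(2 + l.-1) :=
  Emx R l 1 i + Emx R l 3 i + Emx R l i 1 - Emx R l i 3.

Definition M (R : realType) (l : nat) : 'M[R]_(2 + l.-1) :=
  upper_left l [:: [::  0; 1; 0; -1];
                   [:: -1; 0; 1;  0];
                   [::  0; 1; 0; -1];
                   [:: -1; 0; 1;  0]].

Definition L (R : realType) (l : nat) : 'M[R]_(2 + l.-1) :=
  upper_left l [:: [::  0;  1;  0; -1];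
                   [:: -1;  0; -1;  0];
                   [::  0; -1;  0;  1];
                   [:: -1;  0; -1;  0]].

Definition lie_a (R : realType) (l : nat) : {vspace 'M[R]_(2 + l.-1)} :=
  <<[:: J1 R l; J2 R l]>>%VS.

Definition lie_n (R : realType) (l : nat) : {vspace 'M[R]_(2 + l.-1)} :=
  <<[seq W R l i | i <- index_iota 5 l.+2] ++
    [seq V R l i | i <- index_iota 5 l.+2] ++ [:: M R l; L R l]>>%VS.

Definition theta {R : realType} {n : nat} (X : 'M[R]_n) : 'M[R]_n := - X^T.

Definition groupA (R : realType) (l : nat) : set 'M[R]_(2 + l.-1) :=
  [set expmx X | X in [set X | X \in lie_a R l]].

Definition groupN (R : realType) (l : nat) : set 'M[R]_(2 + l.-1) :=
  [set expmx X | X in [set X | X \in lie_n R l]].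

Definition groupNbar (R : realType) (l : nat) : set 'M[R]_(2 + l.-1) :=
  [set expmx (theta X) | X in [set X | X \in lie_n R l]].

Definition iwasawa (R : realType) (l : nat) : set 'M[R]_(2 + l.-1) :=
  [set a *m n | a in groupA R l & n in groupN R l].

Definition iwasawa_bar (R : realType) (l : nat) : set 'M[R]_(2 + l.-1) :=
  [set a *m n | a in groupA R l & n in groupNbar R l].

Definition orbit_of {R : realType} {l : nat} (B : set 'M[R]_(2 + l.-1))
    (p : 'cV[R]_(2 + l.-1)) : set 'cV[R]_(2 + l.-1) :=
  [set b *m p | b in B].

Definition orbits {R : realType} {l : nat} (B : set 'M[R]_(2 + l.-1)) :
  set (set 'cV[R]_(2 + l.-1)) := [set orbit_of B p | p in AdS R l].

Definition closed_orbits (R : realType) (l : nat) :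
    set (set 'cV[R]_(2 + l.-1)) :=
  [set O | (orbits (iwasawa R l) O \/ orbits (iwasawa_bar R l) O) /\
           closed (O : set (subspace (AdS R l)))].

Definition singularity (R : realType) (l : nat) : set 'cV[R]_(2 + l.-1) :=
  \bigcup_(O in closed_orbits R l) O.

Definition BH (R : realType) (l : nat) : set 'cV[R]_(2 + l.-1) :=
  [set p | AdS R l p /\
     forall gamma, future_lightlike_geodesic p gamma ->
       exists2 s : R, 0 <= s & singularity R l (gamma s)].

(* Boundary for the topology of AdS, not of the ambient space. *)
Definition event_horizon (R : realType) (l : nat) :
    set (subspace (AdS R l)) :=
  closure (BH R l : set (subspace (AdS R l))) `\`
  interior (BH R l : set (subspace (AdS R l))).

Definition causal_solvable_symmetric_black_hole (R : realType) (l : nat) :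
    Prop :=
  [/\ singularity R l !=set0,
      singularity R l `<` BH R l &
      BH R l `<` AdS R l].

(* Main.v *)
Require Import Defs.
From mathcomp Require Import all_boot all_order all_algebra.
From mathcomp Require Import all_classical all_reals all_analysis.
From mathcomp Require Import ring lra zify.

Set Implicit Arguments.
Unset Strict Implicit.
Unset Printing Implicit Defensive.

Import Order.TTheory GRing.Theory Num.Theory.
Import numFieldNormedType.Exports.

Local Open Scope classical_set_scope.
Local Open Scope ring_scope.

(** The isometry group acts by matrices, so everything can be read off in the
    null coordinates Tm = t - y, Tp = t + y, Um = u - x, Up = u + x and
    z = (x_3, ..., x_{l-1}), in which the hyperboloid is
    Um Up + Tm Tp - |z|^2 = 1.

    Closed orbits.  N preserves the flag of linear forms Tm; Um; z; Up; Tp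
    (each generator sends a form to a combination of the earlier ones), and A
    scales the null coordinates by positive factors.  Hence the sign of Tm is
    an invariant of the orbits of AN.  If Tm = 0, then Um <> 0, because
    Um Up = 1 + |z|^2, and the sign of Um is the only further invariant: the
    orbit is the half {Tm = 0, Um > 0} or {Tm = 0, Um < 0} ([orbit_null]),
    which is closed.  If Tm <> 0, an element of N moves the point to one with
    Tp = 0; the boosts exp(alpha J1) then shrink Tm to 0 without changing any
    other coordinate, so the orbit has a limit point with Tm = 0 and is not
    closed ([orbit_not_closed]).  The Cartan involution is conjugation by eta
    on the Lie algebra, so the closed orbits of the conjugate group are the
    images under eta of the former, and eta exchanges Tm with -Tp.  There are
    therefore at most four closed orbits, and the singularity is the set
    t^2 = y^2 ([singularityE]).

    Geodesics.  The square of a light-like element of q kills the base point,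
    so its geodesics are straight lines p + s v, with v null and tangent at p.
    That v points to the future means u v_t - t v_u < 0: the left-hand side
    never vanishes on such vectors, by a Cauchy-Schwarz argument, hence it has
    a constant sign on the connected group G ([future_turn]).

    Black hole.  On the circle p = (c, d, 0, ..., 0), c^2 + d^2 = 1, the
    tangency condition and the orientation give v_t = c (c v_t - d v_u) as soon
    as c v_u + d v_t = 0, so v_t < 0 whenever c > 0.  If moreover d > 0, then
    Tm p = Tp p = d > 0 while Tm v + Tp v = 2 v_t < 0, so one of Tm, Tp
    vanishes at some time s > 0: such points are interior ([waist_BH]) without
    being singular.  At the end (0, 1, 0, ..., 0) of this arc, the direction
    v = (1, 0, 1, 0, ...) keeps Tm = Tp = 1 for ever.  That point is exterior
    and a limit of interior points, so it lies on the horizon. *)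

(** * Exponentials of matrices *)

Section MatrixExponential.
Context {R : realType}.

Lemma mx_cvg_coord m n (T : Type) (F : set_system T) {FF : Filter F}
    (f : T -> 'M[R]_(m, n)) (A : 'M[R]_(m, n)) :
  (forall i j, f x i j @[x --> F] --> A i j) -> f x @[x --> F] --> A.
Proof.
move=> fA P [Q AQ QP].
have FQ i : \forall x \near F, forall j, Q i j (f x i j).
  by apply: filter_forall => j; exact: (fA i j _ (AQ i j)).
by apply: filterS (filter_forall FF FQ) => x Qx; exact: QP.
Qed.

(** The sum of the absolute values of all entries is a submultiplicative
    bound, so it dominates powers without introducing an operator norm. *)
Lemma mx_exp_coord_le n (X : 'M[R]_n) k i j :
  `|(X ^+ k) i j| <= (\sum_a \sum_b `|X a b|) ^+ k.
Proof.
have le_sum (a b : 'I_n) : `|X a b| <= \sum_c `|X c b|.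
  by rewrite (bigD1 a)//= lerDl sumr_ge0.
elim: k i j => [|k IHk] i j.
  by rewrite !expr0 mxE; case: (_ == _); rewrite ?normr1 ?normr0.
rewrite !exprSr -mulmxE mxE (le_trans (ler_norm_sum _ _ _))//.
under eq_bigr do rewrite normrM.
apply: (@le_trans _ _ (\sum_c (\sum_a \sum_b `|X a b|) ^+ k * `|X c j|)).
  by apply: ler_sum => c _; rewrite ler_wpM2r.
rewrite -mulr_sumr ler_wpM2l ?exprn_ge0//.
  by apply: sumr_ge0 => a _; exact: sumr_ge0.
by apply: ler_sum => a _; rewrite (bigD1 j)//= lerDl sumr_ge0.
Qed.

(** Since lim is a total operator, the exponential only means something once
    its series converges; here it is dominated by that of a real exponential. *)
Lemma expmx_series_cvg n (X : 'M[R]_n) i j :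
  series (fun k : nat => (k`!%:R)^-1 *: X ^+ k) N i j @[N --> \oo]
    --> expmx X i j.
Proof.
pose u i j : R ^nat := fun k => (k`!%:R)^-1 * (X ^+ k) i j.
have uE N a b :
    series (fun k : nat => (k`!%:R)^-1 *: X ^+ k) N a b = series (u a b) N.
  by rewrite /series/= summxE; apply: eq_bigr => k _; rewrite mxE.
have u_cvg a b : cvgn (series (u a b)).
  apply: normed_cvg; pose S := \sum_a \sum_b `|X a b|.
  apply: (series_le_cvg _ _ _ (is_cvg_series_exp_coeff S)) => k /=.
  - exact: normr_ge0.
  - by rewrite exp_coeff_ge0// sumr_ge0// => c _; exact: sumr_ge0.
  - rewrite /u normrM ger0_norm ?invr_ge0 ?ler0n// exp_coeffE.
    by rewrite ler_wpM2l ?invr_ge0 ?ler0n// mx_exp_coord_le.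
suff -> : expmx X = \matrix_(a, b) limn (series (u a b)).
  rewrite mxE; under eq_fun do rewrite uE; exact: u_cvg.
apply: cvg_lim.
  exact: norm_hausdorff.
apply: mx_cvg_coord => a b; rewrite mxE; under eq_fun do rewrite uE.
exact: u_cvg.
Qed.

(** The form in which the convergence of the exponential is used: the two
    factors cover changes of basis, eigenvectors and the action on a vector. *)
Lemma expmx_mul_cvg m n p (A : 'M[R]_(m, n)) (X : 'M[R]_n)
    (B : 'M[R]_(n, p)) i j :
  \sum_(0 <= k < N) (k`!%:R)^-1 * (A *m X ^+ k *m B) i j @[N --> \oo]
    --> (A *m expmx X *m B) i j.
Proof.
have -> : (fun N => \sum_(0 <= k < N) (k`!%:R)^-1 * (A *m X ^+ k *m B) i j) =
    (fun N => \sum_b \sum_a A i a *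
       series (fun k : nat => (k`!%:R)^-1 *: X ^+ k) N a b * B b j).
  apply/funext => N.
  transitivity ((A *m series (fun k : nat => (k`!%:R)^-1 *: X ^+ k) N
                 *m B) i j).
    rewrite /series/= mulmx_sumr mulmx_suml summxE; apply: eq_bigr => k _.
    by rewrite -scalemxAr -scalemxAl [RHS]mxE.
  by rewrite mxE; apply: eq_bigr => b _; rewrite mxE mulr_suml.
rewrite mxE; under eq_bigr do rewrite mxE mulr_suml.
apply: cvg_big => [|b _]; first exact: add_continuous.
apply: cvg_big => [|a _]; first exact: add_continuous.
by apply: cvgMr_tmp; apply: cvgMl_tmp; exact: expmx_series_cvg.
Qed.

Lemma expmx_conj m n (P : 'M[R]_(m, n)) (Q : 'M[R]_(n, m)) (X : 'M[R]_n) :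
  Q *m P = 1%:M -> P *m Q = 1%:M ->
  expmx (P *m X *m Q) = P *m expmx X *m Q.
Proof.
move=> QP PQ; apply/matrixP => i j.
have powE k : (P *m X *m Q) ^+ k = P *m X ^+ k *m Q.
  elim: k => [|k IHk]; first by rewrite !expr0 mulmx1 PQ.
  by rewrite !exprSr IHk -!mulmxE !mulmxA -[_ *m Q *m P]mulmxA QP mulmx1.
have := @expmx_mul_cvg _ _ _ 1%:M (P *m X *m Q) 1%:M i j.
under eq_fun do under eq_bigr do rewrite mul1mx mulmx1 powE.
rewrite mul1mx mulmx1 => c1.
exact: (cvg_unique (@norm_hausdorff _ R) c1 (@expmx_mul_cvg _ _ _ P X Q i j)).
Qed.

Lemma expmx_eigen n (r : 'rV[R]_n) (X : 'M[R]_n) (c : R) :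
  r *m X = c *: r -> r *m expmx X = expR c *: r.
Proof.
move=> rX; apply/rowP => j.
have rXk k : r *m X ^+ k = c ^+ k *: r.
  elim: k => [|k IHk]; first by rewrite !expr0 mulmx1 scale1r.
  by rewrite exprSr -mulmxE mulmxA IHk -scalemxAl rX scalerA exprSr.
have := @expmx_mul_cvg _ _ _ r X 1%:M 0 j.
rewrite mulmx1.
have -> : (fun N => \sum_(0 <= k < N) (k`!%:R)^-1 * (r *m X ^+ k *m 1%:M) 0 j)
    = (fun N => series (exp_coeff c) N * r 0 j).
  apply/funext => N; rewrite /series/= mulr_suml; apply: eq_bigr => k _.
  by rewrite mulmx1 rXk [in LHS]mxE mulrA exp_coeffE.
move=> c1; rewrite [RHS]mxE; apply: (cvg_unique (@norm_hausdorff _ R) c1).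
by apply: cvgMr_tmp; exact: is_cvg_series_exp_coeff.
Qed.

(** Nilpotency is only asked along v, which is what geodesics require: the
    square of a light-like element of q kills the base point. *)
Lemma expmx_nilpotent n (X : 'M[R]_n) (v : 'cV[R]_n) N :
  X ^+ N *m v = 0 ->
  expmx X *m v = \sum_(0 <= k < N) (k`!%:R)^-1 *: (X ^+ k *m v).
Proof.
move=> XN0; apply/colP => i.
have XkN k : (N <= k)%N -> X ^+ k *m v = 0.
  by move=> Nk; rewrite -(subnK Nk) exprD -mulmxE -mulmxA XN0 mulmx0.
have := @expmx_mul_cvg _ _ _ 1%:M X v i 0.
rewrite mul1mx => c1; apply: (cvg_unique (@norm_hausdorff _ R) c1).
apply: cvg_near_cst; near=> M; rewrite summxE.
have NM : (N <= M)%N by near: M; exact: nbhs_infty_ge.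
rewrite (big_cat_nat (n := N))//= [X in _ + X]big1_seq ?addr0.
  by apply: eq_bigr => k _; rewrite mul1mx [RHS]mxE.
move=> k /andP[_]; rewrite mem_index_iota => /andP[Nk _].
by rewrite mul1mx XkN// mxE mulr0.
Unshelve. all: by end_near. Qed.

End MatrixExponential.

(** * Coordinates and the invariant form *)

(** Coordinates are indexed by natural numbers, from 0, so that sums over
    the last l - 3 of them can be written over an interval; accordingly
    bvec R l k is the basis vector e_(k + 1). *)
Definition crd {R : realType} {l : nat} (p : 'cV[R]_(2 + l.-1)) (k : nat) : R :=
  p (@inord l.-1.+1 k) 0.

Definition bvec (R : realType) (l k : nat) : 'cV[R]_(2 + l.-1) :=
  delta_mx (@inord l.-1.+1 k) 0.

(** The sign makes this form equal to 1 on the hyperboloid, whereas eta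
    gives the coordinates u and t the sign -1. *)
Definition adsform {R : realType} {l : nat} (p q : 'cV[R]_(2 + l.-1)) : R :=
  - (p^T *m eta_mx R 2 l.-1 *m q) 0 0.

Section Coordinates.
Context {R : realType} {l : nat}.
Implicit Types p q r : 'cV[R]_(2 + l.-1).

Lemma crdD p q k : crd (p + q) k = crd p k + crd q k.
Proof. by rewrite /crd mxE. Qed.

Lemma crdN p k : crd (- p) k = - crd p k.
Proof. by rewrite /crd mxE. Qed.

Lemma crdZ (a : R) p k : crd (a *: p) k = a * crd p k.
Proof. by rewrite /crd mxE. Qed.

Lemma crd0 k : crd (0 : 'cV[R]_(2 + l.-1)) k = 0.
Proof. by rewrite /crd mxE. Qed.

Lemma crd_sum (I : Type) (s : seq I) (P : pred I)
    (F : I -> 'cV[R]_(2 + l.-1)) k :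
  crd (\sum_(i <- s | P i) F i) k = \sum_(i <- s | P i) crd (F i) k.
Proof. by rewrite /crd summxE. Qed.

Lemma crd_bvec i k : (i < 2 + l.-1)%N -> (k < 2 + l.-1)%N ->
  crd (bvec R l i) k = (k == i)%:R.
Proof.
move=> il kl; rewrite /crd mxE eqxx andbT.
by rewrite -(inj_eq val_inj)/= !inordK.
Qed.

Lemma crd_inj p q :
  (forall k, (k < 2 + l.-1)%N -> crd p k = crd q k) -> p = q.
Proof.
move=> pq; apply/colP => i; have := pq i (ltn_ord i).
by rewrite /crd inord_val.
Qed.

Lemma adsformDl p q r : adsform (p + q) r = adsform p r + adsform q r.
Proof. by rewrite /adsform raddfD/= !mulmxDl mxE opprD. Qed.

Lemma adsformDr p q r : adsform p (q + r) = adsform p q + adsform p r.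
Proof. by rewrite /adsform !mulmxDr mxE opprD. Qed.

Lemma adsformZl a p q : adsform (a *: p) q = a * adsform p q.
Proof. by rewrite /adsform linearZ/= -!scalemxAl mxE mulrN. Qed.

Lemma adsformZr a p q : adsform p (a *: q) = a * adsform p q.
Proof. by rewrite /adsform -!scalemxAr mxE mulrN. Qed.

Lemma adsform0r p : adsform p 0 = 0.
Proof. by rewrite /adsform mulmx0 mxE oppr0. Qed.

Lemma lshift_inord (i : 'I_2) : lshift l.-1 i = @inord l.-1.+1 i.
Proof. by apply: val_inj; rewrite /= inordK// (leq_trans (ltn_ord i)). Qed.

Lemma rshift_inord (j : 'I_l.-1) : rshift 2 j = @inord l.-1.+1 (2 + j)%N.
Proof. by apply: val_inj; rewrite /= inordK// ltn_add2l. Qed.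

Lemma etaE : eta_mx R 2 l.-1 =
  diag_mx (\row_i (-1) ^+ (i < 2)%N).
Proof.
apply/matrixP => i j; rewrite /eta_mx.
case: (split_ordP i) => a ->; case: (split_ordP j) => b ->.
- rewrite block_mxEul !mxE (inj_eq (@lshift_inj _ _)) /= ltn_ord expr1.
  by rewrite mulNrn.
- by rewrite block_mxEur !mxE eq_lrshift mulr0n.
- by rewrite block_mxEdl !mxE eq_rlshift mulr0n.
- by rewrite block_mxEdr !mxE (inj_eq (@rshift_inj _ _)).
Qed.

Lemma crd_eta p k : (k < 2 + l.-1)%N ->
  crd (eta_mx R 2 l.-1 *m p) k = (-1) ^+ (k < 2)%N * crd p k.
Proof. by move=> kl; rewrite /crd etaE mul_diag_mx !mxE inordK. Qed.

Lemma sum_space (F : nat -> R) : (3 <= l)%N ->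
  \sum_(j < l.-1) F (2 + j)%N = F 2%N + F 3%N + \sum_(4 <= k < l.+1) F k.
Proof.
case: l => [|[|[|n]]]// _.
rewrite !big_ord_recl /= -addrA; congr (_ + (_ + _)).
rewrite -[4%N]/(0 + 4)%N big_addn !subSS subn0 big_mkord.
by apply: eq_bigr => j _; congr F; rewrite /= /bump; lia.
Qed.

Lemma adsformE p q : (3 <= l)%N ->
  adsform p q = crd p 0 * crd q 0 + crd p 1 * crd q 1 - crd p 2 * crd q 2
    - crd p 3 * crd q 3 - \sum_(4 <= k < l.+1) crd p k * crd q k.
Proof.
move=> l3; rewrite /adsform -mulmxA mxE.
transitivity (- \sum_(j < 2 + l.-1) crd p j * crd (eta_mx R 2 l.-1 *m q) j).
  by congr (- _); apply: eq_bigr => j _; rewrite /crd inord_val mxE.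
rewrite (eq_bigr (fun j : 'I_(2 + l.-1) =>
    (-1) ^+ (j < 2)%N * (crd p j * crd q j))).
  rewrite big_split_ord/=.
  under [X in _ + X]eq_bigr do rewrite mul1r.
  rewrite (sum_space (fun k => crd p k * crd q k))// !big_ord_recl big_ord0 /=.
  ring.
by move=> j _; rewrite crd_eta//; ring.
Qed.

Lemma adsformC p q : (3 <= l)%N -> adsform p q = adsform q p.
Proof.
move=> l3; rewrite !adsformE//; under eq_bigr do rewrite mulrC.
ring.
Qed.

Lemma AdSE p : (3 <= l)%N -> AdS R l p <-> adsform p p = 1.
Proof.
move=> l3; rewrite adsformE// /AdS/= (eq_bigr (fun j : 'I_2 => crd p j ^+ 2)).
  rewrite [X in _ - X](eq_bigr (fun j : 'I_l.-1 => crd p (2 + j)%N ^+ 2)).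
    rewrite (sum_space (fun k => crd p k ^+ 2))// !big_ord_recl big_ord0/=.
    under eq_bigr do rewrite expr2.
    by rewrite !expr2 addr0 !opprD !addrA.
  by move=> j _; rewrite /crd rshift_inord.
by move=> j _; rewrite /crd lshift_inord.
Qed.

End Coordinates.

(** * The generators of the Lie algebra *)

Lemma span_ind (K : fieldType) (vT : vectType K) (s : seq vT) (P : vT -> Prop) :
  P 0 -> (forall a x y, P x -> P y -> P (a *: x + y)) ->
  (forall x, x \in s -> P x) -> forall x, x \in << s >>%VS -> P x.
Proof.
move=> P0 PD Ps x /(coord_span (X := in_tuple s)) ->.
elim/big_rec: _ => // i y _ Py; apply: PD => //.
by apply: Ps; rewrite mem_nth.
Qed.

(** The Lie algebra of SO(2, l - 1), written so as to exhibit the Cartan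
    involution as conjugation by eta. *)
Definition eta_skew {R : realType} {l : nat} (X : 'M[R]_(2 + l.-1)) : Prop :=
  theta X = eta_mx R 2 l.-1 *m X *m eta_mx R 2 l.-1.

Section LieAlgebra.
Context {R : realType} {l : nat}.
Implicit Types (X Y : 'M[R]_(2 + l.-1)) (p q : 'cV[R]_(2 + l.-1)).
Local Notation eta := (eta_mx R 2 l.-1).

Lemma eta_invol : eta *m eta = 1%:M.
Proof.
rewrite etaE mul_diag_mx; apply/matrixP => i j; rewrite !mxE.
by rewrite mulrnAr -expr2 sqrr_sign.
Qed.

Lemma tr_eta : eta^T = eta.
Proof. by rewrite etaE tr_diag_mx. Qed.

(** Infinitesimal invariance of eta, obtained by multiplying the definition on
    the right by eta, which is its own inverse. *)
Lemma eta_skewP X : eta_skew X <-> X^T *m eta = - (eta *m X).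
Proof.
rewrite /eta_skew /theta; split => [XE|XE].
  by rewrite -[X^T]opprK XE mulNmx -!mulmxA eta_invol mulmx1.
apply: oppr_inj; rewrite opprK -mulNmx -XE -mulmxA eta_invol mulmx1//.
Qed.

Lemma eta_skew0 : eta_skew (0 : 'M[R]_(2 + l.-1)).
Proof. by rewrite /eta_skew /theta trmx0 mulmx0 mul0mx oppr0. Qed.

Lemma eta_skewD X Y : eta_skew X -> eta_skew Y -> eta_skew (X + Y).
Proof.
rewrite /eta_skew /theta mulmxDr mulmxDl => <- <-.
by rewrite raddfD/= opprD.
Qed.

Lemma eta_skewZ a X : eta_skew X -> eta_skew (a *: X).
Proof.
rewrite /eta_skew /theta -scalemxAr -scalemxAl => <-.
by rewrite linearZ/= scalerN.
Qed.

Lemma eta_skewN X : eta_skew X -> eta_skew (- X).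
Proof. by rewrite -scaleN1r; exact: eta_skewZ. Qed.

Lemma adsform_skew X p q : eta_skew X ->
  adsform (X *m p) q = - adsform p (X *m q).
Proof.
move=> /eta_skewP XE; rewrite /adsform trmx_mul -[p^T *m X^T *m _]mulmxA XE.
by rewrite mulmxN mulNmx !mulmxA mxE.
Qed.

Lemma eta_Emx i j :
  eta *m Emx R l i j *m eta =
  ((-1) ^+ (i <= 2)%N * (-1) ^+ (j <= 2)%N) *: Emx R l i j.
Proof.
rewrite etaE mul_diag_mx mul_mx_diag; apply/matrixP => a b; rewrite !mxE.
case: eqP => [<-|_]; last by rewrite !(mulr0, mul0r).
case: eqP => [<-|_]; last by rewrite !(mulr0, mul0r).
by rewrite /= !mulr1.
Qed.

Lemma theta_Emx i j : theta (Emx R l i j) = - Emx R l j i.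
Proof.
by apply/matrixP => a b; rewrite !mxE andbC.
Qed.

Lemma thetaD X Y : theta (X + Y) = theta X + theta Y.
Proof. by rewrite /theta raddfD opprD. Qed.

Lemma thetaN X : theta (- X) = - theta X.
Proof. by rewrite /theta raddfN. Qed.

Lemma boost_skew i j : (i <= 2 < j)%N -> eta_skew (Emx R l i j + Emx R l j i).
Proof.
move=> /andP[i2 j2]; rewrite /eta_skew thetaD !theta_Emx mulmxDr mulmxDl.
by rewrite !eta_Emx i2 leqNgt j2/= expr1 expr0 mulr1 mul1r !scaleN1r addrC.
Qed.

Lemma rotation_skew i j : (i <= 2)%N = (j <= 2)%N ->
  eta_skew (Emx R l i j - Emx R l j i).
Proof.
move=> ij; rewrite /eta_skew thetaD thetaN !theta_Emx mulmxBr mulmxBl !eta_Emx.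
by rewrite ij -!expr2 sqrr_sign !scale1r opprK addrC.
Qed.

Lemma EmxE i j : (i < 2 + l.-1)%N -> (j < 2 + l.-1)%N ->
  Emx R l i.+1 j.+1 = delta_mx (@inord l.-1.+1 i) (@inord l.-1.+1 j).
Proof.
move=> il jl; apply/matrixP => a b; rewrite !mxE !eqSS.
by rewrite -!(inj_eq val_inj)/= !inordK.
Qed.

Lemma mul_Emx i j p : (i < 2 + l.-1)%N -> (j < 2 + l.-1)%N ->
  Emx R l i.+1 j.+1 *m p = crd p j *: bvec R l i.
Proof.
move=> il jl; rewrite EmxE//; apply/matrixP => a b.
rewrite !mxE (bigD1 (@inord l.-1.+1 j))//= mxE eqxx andbT big1 ?addr0.
  by rewrite mulrC !ord1 eqxx andbT.
by move=> c /negPf jc; rewrite mxE jc andbF mul0r.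
Qed.


Lemma M_Emx : M R l = (Emx R l 1 2 - Emx R l 2 1) - (Emx R l 1 4 + Emx R l 4 1)
  + (Emx R l 2 3 + Emx R l 3 2) - (Emx R l 3 4 - Emx R l 4 3).
Proof.
apply/matrixP => a b; rewrite !mxE.
case: a => [[|[|[|[|a]]]] ?]; case: b => [[|[|[|[|b]]]] ?] /=;
  rewrite ?nth_nil; ring.
Qed.

Lemma L_Emx : L R l = (Emx R l 1 2 - Emx R l 2 1) - (Emx R l 1 4 + Emx R l 4 1)
  - (Emx R l 2 3 + Emx R l 3 2) + (Emx R l 3 4 - Emx R l 4 3).
Proof.
apply/matrixP => a b; rewrite !mxE.
case: a => [[|[|[|[|a]]]] ?]; case: b => [[|[|[|[|b]]]] ?] /=;
  rewrite ?nth_nil; ring.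
Qed.

End LieAlgebra.

(** * The action of the nilpotent algebra *)

(** The general element of the Lie algebra n.  The summation index k is the
    index of a coordinate, one less than that of the generators. *)
Definition nmx (R : realType) (l : nat) (w v : nat -> R) (m lam : R) :
    'M[R]_(2 + l.-1) :=
  \sum_(4 <= k < l.+1) (w k *: W R l k.+1 + v k *: V R l k.+1)
  + m *: M R l + lam *: L R l.

Section IwasawaAction.
Context {R : realType} {l : nat} (hl : (3 <= l)%N).
Implicit Types (X Y : 'M[R]_(2 + l.-1)) (p q : 'cV[R]_(2 + l.-1)).
Local Notation bv := (bvec R l).

Let ltl k : (k < l.+1)%N -> (k < 2 + l.-1)%N.
Proof. by move: hl; lia. Qed.

Let lt4 k : (k < 4)%N -> (k < 2 + l.-1)%N.
Proof. by move: hl; lia. Qed.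

Lemma mul_W k p : (4 <= k < l.+1)%N ->
  W R l k.+1 *m p =
    crd p k *: (bv 1 + bv 3) + (crd p 1 - crd p 3) *: bv k.
Proof.
move=> /andP[_ /ltl kl]; rewrite /W mulmxBl !mulmxDl !mul_Emx// ?lt4//.
by rewrite scalerDr scalerBl addrA.
Qed.

Lemma mul_V k p : (4 <= k < l.+1)%N ->
  V R l k.+1 *m p =
    crd p k *: (bv 0 + bv 2) + (crd p 0 - crd p 2) *: bv k.
Proof.
move=> /andP[_ /ltl kl]; rewrite /V mulmxBl !mulmxDl !mul_Emx// ?lt4//.
by rewrite scalerDr scalerBl addrA.
Qed.

Lemma crd_mul_M p k : (k < l.+1)%N -> crd (M R l *m p) k =
  (crd p 1 - crd p 3) * ((k == 0%N)%:R + (k == 2%N)%:R)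
  + (crd p 2 - crd p 0) * ((k == 1%N)%:R + (k == 3%N)%:R).
Proof.
move=> /ltl kl; rewrite M_Emx !(mulmxDl, mulmxBl, mulNmx) !mul_Emx// ?lt4//.
by rewrite !(crdD, crdN, crdZ) !crd_bvec// ?lt4//; ring.
Qed.

Lemma crd_mul_L p k : (k < l.+1)%N -> crd (L R l *m p) k =
  (crd p 1 - crd p 3) * ((k == 0%N)%:R - (k == 2%N)%:R)
  - (crd p 2 + crd p 0) * ((k == 1%N)%:R + (k == 3%N)%:R).
Proof.
move=> /ltl kl; rewrite L_Emx !(mulmxDl, mulmxBl, mulNmx) !mul_Emx// ?lt4//.
by rewrite !(crdD, crdN, crdZ) !crd_bvec// ?lt4//; ring.
Qed.

Lemma crd_mul_nmx w v m lam p k : (k < l.+1)%N ->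
  crd (nmx l w v m lam *m p) k =
    (k == 0%N)%:R * (\sum_(4 <= j < l.+1) v j * crd p j
                  + (m + lam) * (crd p 1 - crd p 3))
  + (k == 2%N)%:R * (\sum_(4 <= j < l.+1) v j * crd p j
                  + (m - lam) * (crd p 1 - crd p 3))
  + ((k == 1%N)%:R + (k == 3%N)%:R) *
    (\sum_(4 <= j < l.+1) w j * crd p j - m * (crd p 0 - crd p 2)
       - lam * (crd p 0 + crd p 2))
  + (4 <= k)%N%:R * (w k * (crd p 1 - crd p 3) + v k * (crd p 0 - crd p 2)).
Proof.
move=> kl; have kl' := ltl kl; rewrite /nmx !mulmxDl -!scalemxAl mulmx_suml.
rewrite !(crdD, crdZ) crd_sum crd_mul_M// crd_mul_L//.
rewrite (eq_big_nat _ _ (F2 := fun j =>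
   ((k == 1%N)%:R + (k == 3%N)%:R) * (w j * crd p j)
   + ((k == 0%N)%:R + (k == 2%N)%:R) * (v j * crd p j)
   + (if j == k then w j * (crd p 1 - crd p 3) + v j * (crd p 0 - crd p 2)
      else 0))); last first.
  move=> j jl; have /andP[_ /ltl jl'] := jl.
  rewrite mulmxDl -!scalemxAl mul_W// mul_V// !(crdD, crdZ).
  rewrite !crd_bvec// ?lt4//.
  by rewrite [j == k]eq_sym; case: (k == j) => /=; ring.
rewrite !big_split/= -!mulr_sumr -big_mkcond/= big_nat1_eq.
rewrite kl andbT; case: (4 <= k)%N => /=; ring.
Qed.

Lemma nmx_lie_n w v m lam : nmx l w v m lam \in lie_n R l.
Proof.
rewrite !memvD//.
- rewrite big_nat_cond; apply: memv_suml => k /andP[/andP[k4 kl] _].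
  have kl' : k.+1 \in index_iota 5 l.+2 by rewrite mem_index_iota; lia.
  rewrite memvD// memvZ// memv_span// !mem_cat.
    by rewrite (map_f (W R l) kl').
  by rewrite (map_f (V R l) kl') orbT.
- by rewrite memvZ// memv_span// !mem_cat !inE eqxx !orbT.
- by rewrite memvZ// memv_span// !mem_cat !inE eqxx !orbT.
Qed.

Lemma lie_nP X : X \in lie_n R l ->
  exists w v m lam, X = nmx l w v m lam.
Proof.
have single (F : nat -> 'M[R]_(2 + l.-1)) i : i \in index_iota 5 l.+2 ->
    F i = \sum_(4 <= k < l.+1) (k == i.-1)%:R *: F k.+1.
  rewrite mem_index_iota => il.
  rewrite (eq_big_nat _ _ (F2 := fun k => if k == i.-1 then F k.+1 else 0)).
    rewrite -big_mkcond/= big_nat1_eq ifT ?prednK//; lia.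
  by move=> k _; case: eqP; rewrite ?scale1r ?scale0r.
apply: (span_ind (P := fun Z => exists w v m lam, Z = nmx l w v m lam))
  => [|a _ _ [w1 [v1 [m1 [l1 ->]]]] [w2 [v2 [m2 [l2 ->]]]]|Y].
- exists (fun=> 0), (fun=> 0), 0, 0; rewrite /nmx !scale0r big1 ?addr0//.
  by move=> k _; rewrite !scale0r addr0.
- exists (fun k => a * w1 k + w2 k), (fun k => a * v1 k + v2 k),
    (a * m1 + m2), (a * l1 + l2); rewrite /nmx.
  set S1 := \sum_(4 <= k < l.+1) (w1 k *: _ + _).
  set S2 := \sum_(4 <= k < l.+1) (w2 k *: _ + _).
  have -> : \sum_(4 <= k < l.+1) ((a * w1 k + w2 k) *: W R l k.+1
      + (a * v1 k + v2 k) *: V R l k.+1) = a *: S1 + S2.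
    rewrite scaler_sumr -big_split; apply: eq_bigr => k _ /=.
    by rewrite !scalerDl !scalerDr -!scalerA addrACA.
  by apply/matrixP => i j; rewrite !(mxE, summxE); ring.
- rewrite !mem_cat => /or3P[/mapP[i il ->]|/mapP[i il ->]|].
  + exists (fun k => (k == i.-1)%:R), (fun=> 0), 0, 0.
    rewrite /nmx !scale0r !addr0 (single _ _ il).
    by apply: eq_bigr => k _; rewrite scale0r addr0.
  + exists (fun=> 0), (fun k => (k == i.-1)%:R), 0, 0.
    rewrite /nmx !scale0r !addr0 (single _ _ il).
    by apply: eq_bigr => k _; rewrite scale0r add0r.
  + rewrite !inE => /orP[/eqP ->|/eqP ->].
      exists (fun=> 0), (fun=> 0), 1, 0; rewrite /nmx scale0r scale1r addr0.
      by rewrite big1 ?add0r// => k _; rewrite !scale0r addr0.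
    exists (fun=> 0), (fun=> 0), 0, 1; rewrite /nmx scale0r scale1r addr0.
    by rewrite big1 ?add0r// => k _; rewrite !scale0r addr0.
Qed.

(** Each generator is a sum of boosts, which mix one time coordinate with one
    space coordinate, and of rotations, which mix two of the same kind. *)
Lemma lie_n_skew X : X \in lie_n R l -> eta_skew X.
Proof.
apply: (span_ind (P := eta_skew)) => [|a Y Z ? ?|Y].
- exact: eta_skew0.
- by apply: eta_skewD => //; exact: eta_skewZ.
- rewrite !mem_cat => /or3P[/mapP[i + ->]|/mapP[i + ->]|].
  + rewrite mem_index_iota => il.
    have -> : W R l i =
        (Emx R l 2 i + Emx R l i 2) + (Emx R l 4 i - Emx R l i 4).
      by apply/matrixP => a b; rewrite !mxE; ring.
    by apply: eta_skewD; [apply: boost_skew|apply: rotation_skew]; lia.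
  + rewrite mem_index_iota => il.
    have -> : V R l i =
        (Emx R l 1 i + Emx R l i 1) + (Emx R l 3 i - Emx R l i 3).
      by apply/matrixP => a b; rewrite !mxE; ring.
    by apply: eta_skewD; [apply: boost_skew|apply: rotation_skew]; lia.
  + rewrite !inE => /orP[/eqP ->|/eqP ->].
      rewrite M_Emx; apply: eta_skewD; last first.
        by apply: eta_skewN; apply: rotation_skew.
      apply: eta_skewD; last exact: boost_skew.
      apply: eta_skewD; first exact: rotation_skew.
      by apply: eta_skewN; apply: boost_skew.
    rewrite L_Emx; apply: eta_skewD; last exact: rotation_skew.
    apply: eta_skewD; last by apply: eta_skewN; apply: boost_skew.
    apply: eta_skewD; first exact: rotation_skew.
    by apply: eta_skewN; apply: boost_skew.
Qed.

End IwasawaAction.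

(** * Exponentials of n and of a in null coordinates *)

Section NullCoordinates.
Context {R : realType} {l : nat}.
Implicit Types p q : 'cV[R]_(2 + l.-1).

(** The null coordinates t - y, t + y, u - x and u + x.  The weight vectors of
    the Lie algebra a are these four forms and the remaining coordinates. *)
Definition Tm p : R := crd p 1 - crd p 3.
Definition Tp p : R := crd p 1 + crd p 3.
Definition Um p : R := crd p 0 - crd p 2.
Definition Up p : R := crd p 0 + crd p 2.

Lemma null_inj p q : (3 <= l)%N ->
  Tm p = Tm q -> Tp p = Tp q -> Um p = Um q -> Up p = Up q ->
  (forall k, (4 <= k < l.+1)%N -> crd p k = crd q k) -> p = q.
Proof.
rewrite /Tm /Tp /Um /Up => l3 Tme Tpe Ume Upe ze; apply: crd_inj => k kl.
have [k4|] := leqP 4 k; first by apply: ze; lia.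
case: k kl => [|[|[|[|//]]]] _ _; lra.
Qed.

Lemma adsform_null p : (3 <= l)%N ->
  adsform p p = Um p * Up p + Tm p * Tp p - \sum_(4 <= k < l.+1) crd p k ^+ 2.
Proof.
move=> l3; rewrite adsformE//; under eq_bigr do rewrite -expr2.
by rewrite /Tm /Tp /Um /Up; ring.
Qed.

Lemma TmD p q : Tm (p + q) = Tm p + Tm q.
Proof. by rewrite /Tm !crdD; ring. Qed.
Lemma TpD p q : Tp (p + q) = Tp p + Tp q.
Proof. by rewrite /Tp !crdD; ring. Qed.
Lemma UmD p q : Um (p + q) = Um p + Um q.
Proof. by rewrite /Um !crdD; ring. Qed.
Lemma UpD p q : Up (p + q) = Up p + Up q.
Proof. by rewrite /Up !crdD; ring. Qed.
Lemma TmZ a p : Tm (a *: p) = a * Tm p.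
Proof. by rewrite /Tm !crdZ; ring. Qed.
Lemma TpZ a p : Tp (a *: p) = a * Tp p.
Proof. by rewrite /Tp !crdZ; ring. Qed.
Lemma UmZ a p : Um (a *: p) = a * Um p.
Proof. by rewrite /Um !crdZ; ring. Qed.
Lemma UpZ a p : Up (a *: p) = a * Up p.
Proof. by rewrite /Up !crdZ; ring. Qed.

End NullCoordinates.

Section IwasawaExponentials.
Context {R : realType} {l : nat} (hl : (3 <= l)%N).
Implicit Types (X : 'M[R]_(2 + l.-1)) (p q : 'cV[R]_(2 + l.-1)).
Local Notation bv := (bvec R l).

Let lt4 k : (k < 4)%N -> (k < 2 + l.-1)%N.
Proof. by move: hl; lia. Qed.

(** In this order each form is sent to a combination of the previous ones:
    n acts by strictly triangular matrices on the flag Tm; Um; z; Up; Tp. *)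
Lemma nmx_null w v m lam p (X := nmx l w v m lam) :
  [/\ Tm (X *m p) = 0, Um (X *m p) = 2 * lam * Tm p,
      (forall k, (4 <= k < l.+1)%N ->
         crd (X *m p) k = w k * Tm p + v k * Um p),
      Up (X *m p) = 2 * (\sum_(4 <= j < l.+1) v j * crd p j + m * Tm p) &
      Tp (X *m p) = 2 * (\sum_(4 <= j < l.+1) w j * crd p j
                         - m * Um p - lam * Up p)].
Proof.
have lt4' k : (k < 4)%N -> (k < l.+1)%N by move: hl; lia.
rewrite /X; split => [||k /andP[k4 kl]||];
  rewrite /Tm /Um /Up /Tp !crd_mul_nmx// ?lt4'//=; try ring.
have [-> -> -> ->] : [/\ k == 0%N = false, k == 1%N = false,
    k == 2%N = false & k == 3%N = false] by split; lia.
by rewrite k4 /=; ring.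
Qed.

(** The flag has five steps, and each application of X kills one more. *)
Lemma nmx_nilpotent w v m lam p : nmx l w v m lam ^+ 5 *m p = 0.
Proof.
set X := nmx _ _ _ _ _.
have X5 : X ^+ 5 *m p = X *m (X *m (X *m (X *m (X *m p)))).
  by rewrite !exprS expr0 mulr1 -!mulmxE !mulmxA.
rewrite X5.
have null0 : (Tm (0 : 'cV[R]_(2 + l.-1)) = 0) * (Tp (0 : 'cV[R]_(2 + l.-1)) = 0)
   * (Um (0 : 'cV[R]_(2 + l.-1)) = 0) * (Up (0 : 'cV[R]_(2 + l.-1)) = 0).
  by rewrite /Tm /Tp /Um /Up !crd0; do !split; ring.
have [T1 U1 _ _ _] := nmx_null w v m lam p; rewrite -/X in T1 U1.
move: (X *m p) T1 U1 => {p X5} p T1 _.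
have [T2 U2 _ _ _] := nmx_null w v m lam p; rewrite -/X T1 mulr0 in T2 U2.
move: (X *m p) T2 U2 => {p T1} p T1 U1.
have [T2 U2 z2 _ _] := nmx_null w v m lam p.
rewrite -/X T1 U1 ?mulr0 in T2 U2 z2.
move: (X *m p) T2 U2 z2 => {p T1 U1} p T1 U1 z1.
have s0 u q : (forall k, (4 <= k < l.+1)%N -> crd q k = 0) ->
    \sum_(4 <= j < l.+1) u j * crd q j = 0 :> R.
  by move=> q0; rewrite big_nat big1// => j /q0 ->; rewrite mulr0.
have {}z1 k : (4 <= k < l.+1)%N -> crd p k = 0.
  by move=> /z1 ->; rewrite !mulr0 addr0.
have [T2 U2 z2 V2 _] := nmx_null w v m lam p.
rewrite -/X T1 U1 s0// !mulr0 ?addr0 ?mulr0 in T2 U2 z2 V2.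
move: (X *m p) T2 U2 z2 V2 => {p T1 U1 z1} p T1 U1 z1 V1.
have {}z1 k : (4 <= k < l.+1)%N -> crd p k = 0.
  by move=> /z1 ->; rewrite !mulr0 addr0.
have [T2 U2 z2 V2 S2] := nmx_null w v m lam p.
rewrite -/X T1 U1 V1 !s0// !mulr0 ?subr0 ?addr0 ?mulr0 in T2 U2 z2 V2 S2.
apply: null_inj => //; rewrite ?null0// => k /z2 ->.
by rewrite crd0 !mulr0 addr0.
Qed.

Lemma expmx_nmx w v m lam p (X := nmx l w v m lam) :
  expmx X *m p = p + X *m p + 2^-1 *: (X *m (X *m p))
    + 6^-1 *: (X *m (X *m (X *m p)))
    + 24^-1 *: (X *m (X *m (X *m (X *m p)))).
Proof.
rewrite (expmx_nilpotent (nmx_nilpotent w v m lam p)) -/X.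
rewrite !big_nat_recr//= big_geq// add0r !factS fact0 !muln1.
by rewrite !exprS expr0 mulr1 -!mulmxE !mulmxA invr1 mul1mx !scale1r.
Qed.

(** Skewness moves all powers of X to the right, at the cost of a sign.  With
    b m = adsform p (X^m p), the norm of exp X p is the sum over j, k of
    (-1)^j b (j + k) / (j! k!), in which the coefficient of b m vanishes for
    0 < m < 5 by the binomial formula, and b m = 0 for m >= 5. *)
Lemma expmx_nmx_isometry w v m lam p :
  adsform (expmx (nmx l w v m lam) *m p) (expmx (nmx l w v m lam) *m p)
  = adsform p p.
Proof.
set X := nmx l w v m lam.
have Xskew : eta_skew X by apply: (lie_n_skew hl); exact: nmx_lie_n.
have X5 k : X ^+ (5 + k) *m p = 0.
  by rewrite [(5 + k)%N]addnC exprD -mulmxE -mulmxA nmx_nilpotent mulmx0.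
pose b k := adsform p (X ^+ k *m p).
have bE j k : adsform (X ^+ j *m p) (X ^+ k *m p) = (-1) ^+ j * b (j + k)%N.
  elim: j k => [|j IHj] k; first by rewrite expr0 mul1mx mul1r.
  rewrite exprS -mulmxE -mulmxA adsform_skew// mulmxA mulmxE -exprS IHj.
  by rewrite addnS exprS; ring.
have b5 k : b (5 + k)%N = 0 by rewrite /b X5 adsform0r.
rewrite (expmx_nilpotent (nmx_nilpotent w v m lam p)) -/X.
rewrite !big_nat_recr//= big_geq// add0r.
rewrite !(adsformDl, adsformDr, adsformZl, adsformZr) !bE /=.
rewrite -[adsform p p]/(adsform p p) !addSn !add0n.
rewrite (b5 0%N) (b5 1%N) (b5 2%N) (b5 3%N) !factS fact0 !muln1.
have -> : adsform p p = b 0%N by rewrite /b expr0 mul1mx.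
by field.
Qed.

Lemma mul_J1 p : J1 R l *m p = crd p 3 *: bv 1 + crd p 1 *: bv 3.
Proof. by rewrite /J1 mulmxDl !mul_Emx// lt4. Qed.

Lemma mul_J2 p : J2 R l *m p = crd p 2 *: bv 0 + crd p 0 *: bv 2.
Proof. by rewrite /J2 mulmxDl !mul_Emx// lt4. Qed.

Lemma lie_aP X : X \in lie_a R l <->
  exists al be, X = al *: J1 R l + be *: J2 R l.
Proof.
split; last first.
  move=> [al [be ->]].
  by rewrite memvD// memvZ// memv_span// !inE eqxx ?orbT.
apply: (span_ind (P := fun Z => exists al be, Z = al *: J1 R l + be *: J2 R l)).
- by exists 0, 0; rewrite !scale0r addr0.
- move=> a _ _ [a1 [b1 ->]] [a2 [b2 ->]].
  exists (a * a1 + a2), (a * b1 + b2).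
  by rewrite !scalerDl scalerDr !scalerA addrACA.
- move=> Z; rewrite !inE => /orP[] /eqP ->.
    by exists 1, 0; rewrite scale1r scale0r addr0.
  by exists 0, 1; rewrite scale1r scale0r add0r.
Qed.

Lemma lie_a_sym al be :
  (al *: J1 R l + be *: J2 R l)^T = al *: J1 R l + be *: J2 R l.
Proof.
have ET i j : (Emx R l i j)^T = Emx R l j i.
  by apply/matrixP => a b; rewrite !mxE andbC.
rewrite /J1 /J2 linearD/= !linearZ/= !linearD/= !ET.
by congr (_ + _); rewrite ?scalerDr addrC.
Qed.

(** Symmetric matrices have the same left and right eigenvectors, so an
    eigenvector r yields the linear form whose values exp X multiplies. *)
Lemma expmx_sym_eigen X (r : 'cV[R]_(2 + l.-1)) (c : R) : X^T = X ->
  X *m r = c *: r ->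
  forall p, (r^T *m (expmx X *m p)) 0 0 = expR c * (r^T *m p) 0 0.
Proof.
move=> Xs Xr p; rewrite mulmxA (@expmx_eigen _ _ _ _ c).
  by rewrite -scalemxAl mxE.
by rewrite -Xs -trmx_mul Xr linearZ.
Qed.

Lemma bvecT_mul k p : ((bv k)^T *m p) 0 0 = crd p k.
Proof.
rewrite mxE (bigD1 (@inord l.-1.+1 k))//= !mxE !eqxx mul1r big1 ?addr0//.
by move=> j /negPf jk; rewrite !mxE jk mul0r.
Qed.

(** The null coordinates diagonalise a. *)
Lemma expmx_boost al be p (X := al *: J1 R l + be *: J2 R l) :
  [/\ Tm (expmx X *m p) = expR (- al) * Tm p,
      Tp (expmx X *m p) = expR al * Tp p,
      Um (expmx X *m p) = expR (- be) * Um p,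
      Up (expmx X *m p) = expR be * Up p &
      forall k, (4 <= k < l.+1)%N -> crd (expmx X *m p) k = crd p k].
Proof.
have Xs : X^T = X := lie_a_sym al be.
have XE q : X *m q = al *: (crd q 3 *: bv 1 + crd q 1 *: bv 3)
                   + be *: (crd q 2 *: bv 0 + crd q 0 *: bv 2).
  by rewrite /X mulmxDl -!scalemxAl mul_J1 mul_J2.
have pairE i j s q : ((bv i + s *: bv j)^T *m q) 0 0 = crd q i + s * crd q j.
  rewrite linearD/= linearZ/= mulmxDl -scalemxAl mxE [X in _ + X]mxE.
  by rewrite !bvecT_mul.
have eig i j s c : X *m (bv i + s *: bv j) = c *: (bv i + s *: bv j) ->
    crd (expmx X *m p) i + s * crd (expmx X *m p) j
    = expR c * (crd p i + s * crd p j).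
  by move=> /(expmx_sym_eigen Xs)/(_ p); rewrite !pairE.
have crdb i j : (i < 4)%N -> (j < 4)%N -> crd (bv i) j = (j == i)%:R.
  by move=> i4 j4; rewrite crd_bvec ?lt4.
split.
- have := eig 1%N 3%N (-1) (- al).
  rewrite !mulN1r; apply; rewrite XE !(crdD, crdZ) !crdb//=.
  by apply/matrixP => i j; rewrite !mxE; ring.
- have := eig 1%N 3%N 1 al.
  rewrite !mul1r; apply; rewrite XE !(crdD, crdZ) !crdb//=.
  by apply/matrixP => i j; rewrite !mxE; ring.
- have := eig 0%N 2%N (-1) (- be).
  rewrite !mulN1r; apply; rewrite XE !(crdD, crdZ) !crdb//=.
  by apply/matrixP => i j; rewrite !mxE; ring.
- have := eig 0%N 2%N 1 be.
  rewrite !mul1r; apply; rewrite XE !(crdD, crdZ) !crdb//=.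
  by apply/matrixP => i j; rewrite !mxE; ring.
- move=> k /andP[k4 kl]; have := eig k k 0 0.
  rewrite !mul0r !addr0 expR0 mul1r; apply.
  have kb j : (j < 4)%N -> crd (bv k) j = 0.
    have kl' : (k < 2 + l.-1)%N by move: hl; lia.
    move=> j4; have jk : (j == k) = false by lia.
    by rewrite crd_bvec// ?lt4// jk.
  by rewrite XE !(crdD, crdZ) !kb// !(mulr0, scale0r, addr0, scaler0).
Qed.

End IwasawaExponentials.

(** * Orbits of the Iwasawa group *)

(** The closed orbits: Um does not vanish where Tm does, so that the slice
    Tm = 0 has two halves, and s selects one of them by its sign. *)
Definition null_half (R : realType) (l : nat) (s : R) : set 'cV[R]_(2 + l.-1) :=
  [set p | [/\ AdS R l p, Tm p = 0 & 0 < s * Um p]].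

Lemma closed_at_right (R : realType) (U : topologicalType) (f : R -> U)
    (Z : set U) :
  closed Z -> continuous f -> (\forall s \near (0 : R)^'+, Z (f s)) -> Z (f 0).
Proof.
move=> clZ cf Zf; apply: (closed_cvg _ clZ Zf).
by apply: cvg_at_right_filter; exact: cf.
Qed.

Section IwasawaOrbits.
Context {R : realType} {l : nat} (hl : (3 <= l)%N).
Implicit Types (p q : 'cV[R]_(2 + l.-1)).
Local Notation bv := (bvec R l).

Lemma expmx_nmx_Tm_Um w v m lam p (e := expmx (nmx l w v m lam) *m p) :
  Tm e = Tm p /\ Um e = Um p + 2 * lam * Tm p.
Proof.
rewrite /e (expmx_nmx hl); set X := nmx _ _ _ _ _.
have T0 q : Tm (X *m q) = 0 by have [] := nmx_null hl w v m lam q.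
have U0 q : Um (X *m q) = 2 * lam * Tm q by have [] := nmx_null hl w v m lam q.
by rewrite !(TmD, TmZ, UmD, UmZ) !(T0, U0); split; ring.
Qed.

(** With w = 0 and lam = 0 the action on the slice Tm = 0 decouples: v moves
    z and m moves Tp, by arbitrary amounts since Um does not vanish there. *)
Lemma expmx_nmx_horizontal v m p (e := expmx (nmx l (fun=> 0) v m 0) *m p) :
  Tm p = 0 ->
  (forall k, (4 <= k < l.+1)%N -> crd e k = crd p k + v k * Um p) /\
  Tp e = Tp p - 2 * m * Um p.
Proof.
move=> Tp0; rewrite /e (expmx_nmx hl); set X := nmx _ _ _ _ _.
have T0 q : Tm (X *m q) = 0 by have [] := nmx_null hl (fun=> 0) v m 0 q.
have U0 q : Um (X *m q) = 0.
  by have [_ -> _ _ _] := nmx_null hl (fun=> 0) v m 0 q; rewrite mulr0 mul0r.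
have z q k : (4 <= k < l.+1)%N -> crd (X *m q) k = v k * Um q.
  have [_ _ zq _ _] := nmx_null hl (fun=> 0) v m 0 q.
  by move=> /zq ->; rewrite mul0r add0r.
have S q : Tp (X *m q) = - 2 * m * Um q.
  have [_ _ _ _ ->] := nmx_null hl (fun=> 0) v m 0 q.
  by rewrite big1 => [|i _]; [ring|rewrite mul0r].
split=> [k kl|]; first by rewrite !(crdD, crdZ) !z// !U0; ring.
by rewrite !(TpD, TpZ) !S !U0; ring.
Qed.

(** The quadratic term 4 m lam Tm is what allows Tp to be brought to 0 even
    where Um and Up both vanish. *)
Lemma expmx_nmx_ML m lam p
    (e := expmx (nmx l (fun=> 0) (fun=> 0) m lam) *m p) :
  Tp e = Tp p - 2 * m * Um p - 2 * lam * Up p - 4 * m * lam * Tm p.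
Proof.
rewrite /e (expmx_nmx hl); set X := nmx _ _ _ _ _.
have n := nmx_null hl (fun=> 0) (fun=> 0) m lam.
have T0 q : Tm (X *m q) = 0 by have [] := n q.
have U0 q : Um (X *m q) = 2 * lam * Tm q by have [] := n q.
have V0 q : Up (X *m q) = 2 * m * Tm q.
  by have [_ _ _ -> _] := n q; rewrite big1 => [|i _]; [ring|rewrite mul0r].
have S q : Tp (X *m q) = - 2 * m * Um q - 2 * lam * Up q.
  by have [_ _ _ _ ->] := n q; rewrite big1 => [|i _]; [ring|rewrite mul0r].
by rewrite !(TpD, TpZ) !S !U0 !V0 !T0; field.
Qed.

Lemma boost_isometry al be p
    (e := expmx (al *: J1 R l + be *: J2 R l) *m p) :
  adsform e e = adsform p p.
Proof.
have [T1 T2 U1 U2 z] := expmx_boost hl al be p; rewrite !adsform_null//.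
rewrite /e T1 T2 U1 U2 (eq_big_nat _ _ (F2 := fun k => crd p k ^+ 2)).
  congr (_ + _ - _).
    by rewrite mulrACA -expRD addNr expR0 mul1r.
  by rewrite mulrACA -expRD addNr expR0 mul1r.
by move=> k /z ->.
Qed.

Lemma iwasawaP b : iwasawa R l b <-> exists al be w v m lam,
  b = expmx (al *: J1 R l + be *: J2 R l) *m expmx (nmx l w v m lam).
Proof.
split.
  move=> [_ [X /lie_aP [al [be ->]] <-]].
  move=> [_ [Y /(lie_nP hl) [w [v [m [lam ->]]]] <-] <-].
  by exists al, be, w, v, m, lam.
move=> [al [be [w [v [m [lam ->]]]]]].
exists (expmx (al *: J1 R l + be *: J2 R l)).
  by exists (al *: J1 R l + be *: J2 R l) => //; apply/lie_aP; exists al, be.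
exists (expmx (nmx l w v m lam)) => //.
by exists (nmx l w v m lam) => //; exact: nmx_lie_n.
Qed.

Lemma iwasawa_isometry b p : iwasawa R l b ->
  adsform (b *m p) (b *m p) = adsform p p.
Proof.
move=> /iwasawaP[al [be [w [v [m [lam ->]]]]]].
by rewrite -mulmxA boost_isometry expmx_nmx_isometry.
Qed.

Lemma iwasawa_Tm b p : iwasawa R l b ->
  exists2 c, 0 < c & Tm (b *m p) = c * Tm p.
Proof.
move=> /iwasawaP[al [be [w [v [m [lam ->]]]]]].
exists (expR (- al)); first exact: expR_gt0.
have [T1 _] := expmx_nmx_Tm_Um w v m lam p.
have [T2 _ _ _ _] := expmx_boost hl al be (expmx (nmx l w v m lam) *m p).
by rewrite -mulmxA T2 T1.
Qed.

Lemma iwasawa_Um b p : iwasawa R l b -> Tm p = 0 ->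
  exists2 c, 0 < c & Um (b *m p) = c * Um p.
Proof.
move=> /iwasawaP[al [be [w [v [m [lam ->]]]]]] T0.
exists (expR (- be)); first exact: expR_gt0.
have [_ U1] := expmx_nmx_Tm_Um w v m lam p.
have [_ _ U2 _ _] := expmx_boost hl al be (expmx (nmx l w v m lam) *m p).
by rewrite -mulmxA U2 U1 T0 mulr0 addr0.
Qed.

(** On the slice, the equation of the hyperboloid reads Um Up = 1 + |z|^2. *)
Lemma AdS_Um p : AdS R l p -> Tm p = 0 -> Um p != 0.
Proof.
move=> /(AdSE _ hl); rewrite adsform_null// => pp T0.
apply/eqP => U0; move: pp; rewrite T0 U0 !mul0r addr0 sub0r => pp.
have : 0 <= \sum_(4 <= k < l.+1) crd p k ^+ 2.
  by apply: sumr_ge0 => k _; exact: sqr_ge0.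
by lra.
Qed.

(** To join p to q, a boost in the (u, x) plane adjusts the size of Um, then v
    and m adjust z and Tp; the equation of the hyperboloid gives Up. *)
Lemma orbit_null p : AdS R l p -> Tm p = 0 ->
  orbit_of (iwasawa R l) p = null_half (Um p).
Proof.
move=> pA T0; have U0 := AdS_Um pA T0; apply/seteqP; split=> q.
  move=> [b bR <-]; split.
  - by apply/(AdSE _ hl); rewrite iwasawa_isometry//; exact/(AdSE _ hl).
  - by have [c _ ->] := iwasawa_Tm p bR; rewrite T0 mulr0.
  - have [c c0 ->] := iwasawa_Um bR T0.
    by rewrite mulrCA mulr_gt0// -expr2 exprn_even_gt0.
move=> [qA Tq Uq].
(* With these values of v and m, and a boost by the ratio of the two Um, the
   image of p has the same z, Tp and Um as q. *)
pose v k := (crd q k - crd p k) / Um p.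
pose m := (Tp p - Tp q) / (2 * Um p).
have r0 : 0 < Um q / Um p.
  rewrite -(pmulr_lgt0 _ (_ : 0 < Um p ^+ 2)) ?exprn_even_gt0//.
  by rewrite expr2 mulrA divfK// mulrC.
pose b := expmx (0 *: J1 R l + (- ln (Um q / Um p)) *: J2 R l)
        *m expmx (nmx l (fun=> 0) v m 0).
have bR : iwasawa R l b.
  by apply/iwasawaP; exists 0, (- ln (Um q / Um p)), (fun=> 0), v, m, 0.
exists b => //.
have [T1 U1] := expmx_nmx_Tm_Um (fun=> 0) v m 0 p.
have [z1 S1] := expmx_nmx_horizontal v m T0.
have [T2 S2 U2 _ z2] := expmx_boost hl 0 (- ln (Um q / Um p))
  (expmx (nmx l (fun=> 0) v m 0) *m p).
rewrite !mulmxA -/b in T2 S2 U2 z2.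
have Tb : Tm (b *m p) = Tm q by rewrite T2 T1 T0 mulr0 Tq.
have Sb : Tp (b *m p) = Tp q.
  by rewrite S2 S1 expR0 /m; field.
have Ub : Um (b *m p) = Um q.
  by rewrite U2 U1 opprK lnK ?posrE// T0 mulr0 addr0 divfK.
have zb k : (4 <= k < l.+1)%N -> crd (b *m p) k = crd q k.
  by move=> kl; rewrite z2// z1// /v; field.
apply: null_inj => //.
have /(AdSE _ hl) qq := qA; have /(AdSE _ hl) pp := pA.
have := iwasawa_isometry p bR; rewrite pp -qq !adsform_null//.
rewrite (eq_big_nat _ _ (F2 := fun k => crd q k ^+ 2)); last by move=> k /zb ->.
rewrite Tb Ub Tq !mul0r !addr0 => /addIr /mulfI; apply.
exact: AdS_Um.
Qed.

Lemma crd_continuous k : continuous (fun p : 'cV[R]_(2 + l.-1) => crd p k).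
Proof. by move=> p; rewrite /crd; exact: coord_continuous. Qed.

Lemma Tm_continuous : continuous (@Tm R l).
Proof. move=> p; exact: (cvgB (@crd_continuous 1 p) (@crd_continuous 3 p)). Qed.

Lemma Um_continuous : continuous (@Um R l).
Proof. move=> p; exact: (cvgB (@crd_continuous 0 p) (@crd_continuous 2 p)). Qed.

(** Since Um does not vanish on the slice, the strict inequality that defines
    the half may be replaced by a large one. *)
Lemma closed_null_half s : s != 0 ->
  closed (null_half s : set (subspace (AdS R l))).
Proof.
move=> s0; apply/closed_subspaceP.
exists ([set p | Tm p = 0] `&` [set p | 0 <= s * Um p]).
  apply: closedI.
    by move/continuous_closedP : Tm_continuous => /(_ _ (@closed_eq R 0)).
  have /continuous_closedP/(_ _ (@closed_ge R 0)) :
      continuous (fun p : 'cV[R]_(2 + l.-1) => s * Um p).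
    by move=> p; exact: (cvgM (cvg_cst s) (@Um_continuous p)).
  exact.
apply/seteqP; split=> p /=.
  move=> [[T0 U0] pA]; split=> //; split=> //.
  by rewrite lt_neqAle U0 andbT eq_sym mulf_neq0// AdS_Um.
by move=> [[_ T0 /ltW U0] pA].
Qed.

(** The orbit contains an open ray of the line f, whose origin f 0 has Tm = 0
    and thus lies outside the orbit, but on its closure. *)
Lemma orbit_not_closed p : AdS R l p -> Tm p != 0 ->
  ~ closed (orbit_of (iwasawa R l) p : set (subspace (AdS R l))).
Proof.
move=> pA T0 /closed_subspaceP[Z clZ ZA].
(* The choice of lam normalises Um + 2 lam Tm to 1, and m then solves Tp = 0,
   whose coefficient in m is - 2 (Um + 2 lam Tm). *)
pose lam := (1 - Um p) / (2 * Tm p).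
pose m := (Tp p - 2 * lam * Up p) / 2.
pose q0 := expmx (nmx l (fun=> 0) (fun=> 0) m lam) *m p.
have [Tq0 _] := expmx_nmx_Tm_Um (fun=> 0) (fun=> 0) m lam p.
have Sq0 : Tp q0 = 0.
  by rewrite /q0 expmx_nmx_ML /m /lam; field.
have q0q0 : adsform q0 q0 = 1 by rewrite /q0 expmx_nmx_isometry//; exact/AdSE.
pose d := (Tm p / 2) *: (bv 1 - bv 3).
pose f (s : R) := (q0 - d) + s *: d.
have crdd k : (k < l.+1)%N ->
    crd d k = (Tm p / 2) * ((k == 1%N)%:R - (k == 3%N)%:R).
  by move=> kl; rewrite /d crdZ crdD crdN !crd_bvec//; move: hl; lia.
have [Td Sd Ud Vd] : [/\ Tm d = Tm p, Tp d = 0, Um d = 0 & Up d = 0].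
  rewrite /Tm /Tp /Um /Up !crdd; [|by move: hl; lia..].
  by split; rewrite /= /Tm; field.
have zd k : (4 <= k < l.+1)%N -> crd d k = 0.
  move=> kl; rewrite crdd; last by lia.
  have [-> ->] : (k == 1%N) = false /\ (k == 3%N) = false by lia.
  by rewrite subrr mulr0.
clearbody d.
have fE s : [/\ Tm (f s) = s * Tm p, Tp (f s) = 0, Um (f s) = Um q0,
    Up (f s) = Up q0 & forall k, (4 <= k < l.+1)%N -> crd (f s) k = crd q0 k].
  rewrite /f -scaleN1r; split => [||||k kl];
    rewrite !(TmD, TmZ, TpD, TpZ, UmD, UmZ, UpD, UpZ, crdD, crdZ).
  - by rewrite Td -/q0 Tq0; ring.
  - by rewrite Sd Sq0; ring.
  - by rewrite Ud; ring.
  - by rewrite Vd; ring.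
  - by rewrite zd//; ring.
have fO s : 0 < s -> orbit_of (iwasawa R l) p (f s).
  move=> s0; exists (expmx ((- ln s) *: J1 R l + 0 *: J2 R l)
    *m expmx (nmx l (fun=> 0) (fun=> 0) m lam)).
    by apply/iwasawaP; exists (- ln s), 0, (fun=> 0), (fun=> 0), m, lam.
  have [T2 S2 U2 V2 z2] := expmx_boost hl (- ln s) 0 q0.
  have [T3 S3 U3 V3 z3] := fE s.
  rewrite -mulmxA -/q0; apply: null_inj => //.
  - by rewrite T2 T3 opprK lnK ?posrE// Tq0.
  - by rewrite S2 S3 Sq0 mulr0.
  - by rewrite U2 U3 oppr0 expR0 mul1r.
  - by rewrite V2 V3 expR0 mul1r.
  - by move=> k kl; rewrite z2// z3.
have AdSf s : AdS R l (f s).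
  apply/AdSE => //; rewrite -q0q0 !adsform_null//; have [_ -> -> -> zf] := fE s.
  rewrite Sq0 !mulr0; congr (_ - _).
  by apply: eq_big_nat => k /zf ->.
have : Z (f 0).
  apply: (closed_at_right clZ).
    move=> s; apply: cvgD; first exact: cvg_cst.
    by apply: cvgZr_tmp; exact: cvg_id.
  near=> s.
  have : (orbit_of (iwasawa R l) p `&` AdS R l) (f s).
    by split=> //; apply: fO; near: s; exact: nbhs_right_gt.
  by rewrite -ZA => -[].
move=> Zf0; have : (orbit_of (iwasawa R l) p `&` AdS R l) (f 0).
  by rewrite -ZA.
move=> [[b bR bf] _]; have [c c0] := iwasawa_Tm p bR.
rewrite bf; have [-> _ _ _ _] := fE 0.
move=> /esym/eqP; rewrite mul0r mulf_eq0 (negPf T0) gt_eqF.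
Unshelve. all: by end_near. Qed.

End IwasawaOrbits.

(** * The conjugate group and the singularity *)

Section Singularity.
Context {R : realType} {l : nat} (hl : (3 <= l)%N).
Implicit Types (p q : 'cV[R]_(2 + l.-1)) (O : set 'cV[R]_(2 + l.-1)).
Local Notation eta := (eta_mx R 2 l.-1).

Let lt4 k : (k < 4)%N -> (k < 2 + l.-1)%N.
Proof. by move: hl; lia. Qed.

Lemma Tm_eta p : Tm (eta *m p) = - Tp p.
Proof. by rewrite /Tm /Tp !crd_eta ?lt4//=; ring. Qed.

Lemma etaK p : eta *m (eta *m p) = p.
Proof. by rewrite mulmxA eta_invol mul1mx. Qed.

Lemma AdS_eta p : AdS R l p -> AdS R l (eta *m p).
Proof.
move=> /(AdSE _ hl) pp; apply/(AdSE _ hl); rewrite -pp /adsform.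
by rewrite trmx_mul tr_eta -[_ *m (eta *m p)]mulmxA etaK -!mulmxA.
Qed.

(** On the symmetric matrices of a the involution is X |-> - X, so that A is
    stable under conjugation by eta; on n it is that conjugation. *)
Lemma iwasawa_barP b : iwasawa_bar R l b <->
  exists2 b', iwasawa R l b' & b = eta *m b' *m eta.
Proof.
have conj X : expmx (eta *m X *m eta) = eta *m expmx X *m eta.
  by apply: expmx_conj; exact: eta_invol.
have Na X : X \in lie_a R l -> expmx X = eta *m expmx (- X) *m eta.
  move=> /lie_aP[al [be ->]].
  have Jskew : eta_skew (al *: J1 R l + be *: J2 R l).
    by apply: eta_skewD; apply: eta_skewZ; apply: boost_skew.
  rewrite -conj; congr expmx.
  move: Jskew; rewrite /eta_skew /theta lie_a_sym mulmxN mulNmx => <-.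
  by rewrite opprK.
have Nn X : X \in lie_n R l -> expmx (theta X) = eta *m expmx X *m eta.
  by move=> /lie_n_skew ->; rewrite ?conj.
have etaM (A B : 'M[R]_(2 + l.-1)) :
    (eta *m A *m eta) *m (eta *m B *m eta) = eta *m (A *m B) *m eta.
  by rewrite !mulmxA -[_ *m eta *m eta]mulmxA eta_invol mulmx1.
split.
  move=> [_ [X Xa <-] [_ [Y Yn <-] <-]].
  exists (expmx (- X) *m expmx Y); last by rewrite Na// Nn// etaM.
  exists (expmx (- X)); first by exists (- X) => //=; rewrite memvN.
  by exists (expmx Y) => //; exists Y.
move=> [_ [_ [X Xa <-] [_ [Y Yn <-] <-]] ->].
exists (expmx (- X)); first by exists (- X) => //=; rewrite memvN.
exists (expmx (theta Y)); first by exists Y.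
by rewrite Na ?memvN// Nn// opprK etaM.
Qed.

Lemma orbit_bar p :
  orbit_of (iwasawa_bar R l) p =
  [set eta *m q | q in orbit_of (iwasawa R l) (eta *m p)].
Proof.
apply/seteqP; split=> q.
  move=> [b /iwasawa_barP[b' b'R ->] <-].
  by exists (b' *m (eta *m p)); [exists b'|rewrite !mulmxA].
move=> [_ [b bR <-] <-]; exists (eta *m b *m eta); last by rewrite !mulmxA.
by apply/iwasawa_barP; exists b.
Qed.

Lemma eta_continuous : continuous (fun p => eta *m p).
Proof.
have E q i j : (eta *m q) i j = (-1) ^+ (i < 2)%N * q i j.
  by rewrite etaE mul_diag_mx !mxE.
move=> p; have FF : Filter (nbhs p) by exact: nbhs_filter.
apply: mx_cvg_coord => i j; under eq_fun do rewrite E.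
rewrite E; exact: (cvgM (cvg_cst _) (@coord_continuous _ _ _ i j p)).
Qed.

Lemma closed_eta O : O `<=` AdS R l ->
  closed (O : set (subspace (AdS R l))) ->
  closed ([set eta *m q | q in O] : set (subspace (AdS R l))).
Proof.
move=> OA /closed_subspaceP[Z clZ ZO]; apply/closed_subspaceP.
exists ((fun p => eta *m p) @^-1` Z).
  by move/continuous_closedP : eta_continuous => /(_ _ clZ).
apply/seteqP; split=> q /= [qZ qA]; split=> //.
  have : (Z `&` AdS R l) (eta *m q) by split=> //; exact: AdS_eta.
  by rewrite ZO => -[qO _]; exists (eta *m q) => //; rewrite etaK.
case: qZ => r rO <-; rewrite etaK.
have : (O `&` AdS R l) r by split=> //; exact: OA.
by rewrite -ZO => -[].
Qed.

Lemma orbit_sub_AdS p : AdS R l p -> orbit_of (iwasawa R l) p `<=` AdS R l.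
Proof.
move=> pA _ [b bR <-]; apply/AdSE => //.
by rewrite iwasawa_isometry//; exact/AdSE.
Qed.

Lemma null_half_sg (s : R) :
  null_half s = null_half (Num.sg s) :> set 'cV[R]_(2 + l.-1).
Proof.
have sE x : (0 < Num.sg s * x) = (0 < s * x).
  by rewrite -sgr_gt0 -[RHS]sgr_gt0 !sgrM sgr_id.
by apply/seteqP; split=> p [pA T0]; rewrite ?sE => sU; split; rewrite ?sE.
Qed.

Lemma closed_orbit_iwasawa p : AdS R l p ->
  closed (orbit_of (iwasawa R l) p : set (subspace (AdS R l))) ->
  Tm p = 0 /\ orbit_of (iwasawa R l) p = null_half (Num.sg (Um p)).
Proof.
move=> pA clO; have T0 : Tm p = 0.
  by apply/eqP; apply/negPn/negP => T0; exact: (orbit_not_closed hl pA T0 clO).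
by split=> //; rewrite (orbit_null hl)// [LHS]null_half_sg.
Qed.

(** An orbit of the conjugate group is the image under eta of an orbit of AN,
    and eta is a homeomorphism of the hyperboloid, so that it preserves and
    reflects closedness. *)
Lemma closed_orbits_sub : closed_orbits R l `<=`
  [set null_half 1; null_half (-1)] `|`
  [set [set eta *m q | q in null_half 1]; [set eta *m q | q in null_half (-1)]].
Proof.
have sg1 p : AdS R l p -> Tm p = 0 -> Num.sg (Um p) = 1 \/ Num.sg (Um p) = -1.
  move=> pA T0; have := AdS_Um hl pA T0.
  by case: sgrP => // _ _; [left|right].
move=> O [[[p pA <-]|[p pA <-]] clO].
  left; have [T0 ->] := closed_orbit_iwasawa pA clO.
  by have [->|->] := sg1 _ pA T0; [left|right].
right; have pA' := AdS_eta pA.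
have clO' :
    closed (orbit_of (iwasawa R l) (eta *m p) : set (subspace (AdS R l))).
  have -> : orbit_of (iwasawa R l) (eta *m p)
      = [set eta *m q | q in orbit_of (iwasawa_bar R l) p].
    rewrite orbit_bar image_comp; apply/seteqP; split=> q.
      by exists q => //=; rewrite etaK.
    by move=> [r rO <-] /=; rewrite etaK.
  apply: closed_eta clO; rewrite orbit_bar => _ [q /(orbit_sub_AdS pA') qA <-].
  exact: AdS_eta.
have [T0 OE] := closed_orbit_iwasawa pA' clO'; rewrite orbit_bar OE.
by have [->|->] := sg1 _ pA' T0; [left|right].
Qed.

Lemma closed_orbits_finite : finite_set (closed_orbits R l).
Proof.
apply: sub_finite_set closed_orbits_sub _.
by rewrite finite_setU; split; exact: finite_set2.
Qed.

Lemma singularityE :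
  singularity R l = [set p | AdS R l p /\ (Tm p = 0 \/ Tp p = 0)].
Proof.
apply/seteqP; split=> p.
  move=> [ X /closed_orbits_sub].
  have half s q : null_half s q -> AdS R l q /\ (Tm q = 0 \/ Tp q = 0).
    by move=> [qA T0 _]; split=> //; left.
  have half_eta s q : [set eta *m q | q in null_half s] q ->
      AdS R l q /\ (Tm q = 0 \/ Tp q = 0).
    move=> [r [rA T0 _] <-]; split; first exact: AdS_eta.
    by right; apply/eqP; rewrite -oppr_eq0 -Tm_eta etaK T0.
  by move=> [[|]|[|]] /= ->;
    [exact: half|exact: half|exact: half_eta|exact: half_eta].
have half q : AdS R l q -> Tm q = 0 -> orbit_of (iwasawa R l) q q /\
    closed (orbit_of (iwasawa R l) q : set (subspace (AdS R l))).
  move=> qA T0; rewrite orbit_null//; have U0 := AdS_Um hl qA T0.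
  split; last exact: closed_null_half.
  by split=> //; rewrite -expr2 exprn_even_gt0.
move=> [pA [T0|T0]].
  exists (orbit_of (iwasawa R l) p); last by have [] := half p pA T0.
  by split; [left; exists p|have [] := half p pA T0].
have pA' := AdS_eta pA.
have Tp0 : Tm (eta *m p) = 0 by rewrite Tm_eta T0 oppr0.
have [pO clO] := half _ pA' Tp0.
exists (orbit_of (iwasawa_bar R l) p); last first.
  by rewrite orbit_bar; exists (eta *m p) => //; rewrite etaK.
split; first by right; exists p.
by rewrite orbit_bar; apply: closed_eta => //; exact: orbit_sub_AdS.
Qed.

End Singularity.

(** * Future light-like geodesics *)

Section LightlikeGeodesics.
Context {R : realType} {l : nat} (hl : (3 <= l)%N).
Implicit Types (p q f : 'cV[R]_(2 + l.-1)) (g k : 'M[R]_(2 + l.-1)).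
Local Notation bv := (bvec R l).

Let lt4 i : (i < 4)%N -> (i < 2 + l.-1)%N.
Proof. by move: hl; lia. Qed.

Let crdb i j : (i < 4)%N -> (j < 4)%N -> crd (bv i) j = (j == i)%:R.
Proof. by move=> i4 j4; rewrite crd_bvec ?lt4. Qed.

Let adsform_b i p : (i < 2)%N -> adsform (bv i) p = crd p i.
Proof.
move=> i2; have i4 : (i < 4)%N by lia.
rewrite adsformE// !crdb// big_nat big1.
  by case: i i2 i4 => [|[|]]//= _ _; ring.
move=> j jl; rewrite crd_bvec; [|move: hl; lia..].
by rewrite (_ : j == i = false) ?mul0r//; lia.
Qed.

Lemma SO_isometry g p q : SO R 2 l.-1 g ->
  adsform (g *m p) (g *m q) = adsform p q.
Proof.
move=> [_ gg]; rewrite /adsform trmx_mul -[in RHS]gg.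
by rewrite !mulmxA.
Qed.

Lemma mul_E1 p : E1 R l *m p =
  (crd p 1 + crd p 2) *: bv 0 + crd p 0 *: (bv 2 - bv 1).
Proof.
rewrite /E1 /q0 /q !mulmxDl mulNmx !mul_Emx ?lt4//.
by rewrite scalerBr scalerDl !addrA; apply/matrixP => i j; rewrite !mxE; ring.
Qed.

Lemma proj_AdSE g : proj_AdS g = g *m bv 0.
Proof.
rewrite /proj_AdS /bvec; congr (g *m delta_mx _ _).
by apply: val_inj; rewrite /= inordK.
Qed.

Lemma KH_fix k i : KH R l k -> (i < 2)%N -> k *m bv i = bv i.
Proof.
move=> [K _ <-] i2.
have -> : bv i = col_mx (delta_mx (Ordinal i2) 0) 0.
  apply/colP => j; rewrite /bvec.
  case: (split_ordP j) => a ->; rewrite ?col_mxEu ?col_mxEd !mxE !eqxx ?andbT.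
    rewrite -!(inj_eq val_inj)/= inordK//; lia.
  rewrite -(inj_eq val_inj)/= inordK//; [case: eqP => //; lia|lia].
by rewrite mul_block_col !mul0mx mul1mx mulmx0 !addr0.
Qed.

Lemma KH_SO k : KH R l k -> SO R 2 l.-1 k.
Proof.
move=> [K [dK KK] <-]; split; first by rewrite det_ublock det1 mul1r.
rewrite /eta_mx tr_block_mx !mulmx_block !trmx0 trmx1.
by rewrite !(mulmx0, mul0mx, addr0, add0r, mul1mx, mulmx1) KK.
Qed.

(** Both directions of time are fixed by K_H, and E_1 sends the base point e_1
    to the null vector e_3 - e_2, which it kills: the exponential series stops
    after its linear term. *)
Lemma geodesicE g k s : KH R l k ->
  proj_AdS (g *m expmx (s *: Ad k (E1 R l))) =
  g *m bv 0 + s *: (g *m (k *m (bv 2 - bv 1))).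
Proof.
move=> kK; rewrite proj_AdSE; set Y := s *: _.
have k1 : k \in unitmx by rewrite unitmxE (proj1 (KH_SO kK)) unitr1.
have Yk q : Y *m (k *m q) = s *: (k *m (E1 R l *m q)).
  by rewrite /Y /Ad -scalemxAl -!mulmxA mulKmx.
have Y0 : Y *m bv 0 = s *: (k *m (bv 2 - bv 1)).
  rewrite -(KH_fix kK (isT : (0 < 2)%N)) Yk mul_E1 !crdb//=.
  by rewrite addr0 scale0r add0r scale1r.
rewrite -mulmxA (expmx_nilpotent (N := 2)).
  rewrite !big_nat_recr//= big_geq// add0r expr0 expr1 invr1 !scale1r mul1mx.
  by rewrite mulmxDr Y0 -scalemxAr.
rewrite exprS expr1 -mulmxE -mulmxA Y0 -scalemxAr Yk mul_E1.
have -> : crd (bv 2 - bv 1) 1 + crd (bv 2 - bv 1) 2 = 0.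
  by rewrite !(crdD, crdN) !crdb//=; ring.
by rewrite crdD crdN !crdb//= subrr !scale0r addr0 mulmx0 !scaler0.
Qed.

(** What the sequel needs to know of a geodesic.  The value -1 of the time
    coordinate of f records the orientation: q_0 sends e_1 to - e_2. *)
Lemma geodesicP p gamma : future_lightlike_geodesic p gamma ->
  exists g f, [/\ groupG R l g, g *m bv 0 = p,
    [/\ adsform f f = 0, crd f 0 = 0 & crd f 1 = -1] &
    forall s, gamma s = p + s *: (g *m f)].
Proof.
move=> [g [k [gG kK <- ->]]]; rewrite proj_AdSE.
have kS := KH_SO kK.
exists g, (k *m (bv 2 - bv 1)); split=> //; last by move=> s; exact: geodesicE.
have crdk i q : (i < 2)%N -> crd (k *m q) i = crd q i.
  by move=> i2; rewrite -!adsform_b// -(KH_fix kK i2) SO_isometry// KH_fix.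
rewrite SO_isometry// !crdk// !(crdD, crdN) !crdb//=.
split; [|by ring|by ring].
rewrite adsformE// !(crdD, crdN) !crdb//= big_nat big1; first by ring.
move=> j jl; rewrite crdD crdN !crd_bvec; [|move: hl; lia..].
have [-> ->] : j == 2%N = false /\ j == 1%N = false by lia.
by rewrite subrr mul0r.
Qed.

Lemma crd_mul_continuous c i :
  continuous (fun g : 'M[R]_(2 + l.-1) => crd (g *m c) i).
Proof.
move=> g; have FF : Filter (nbhs g) by exact: nbhs_filter.
rewrite /crd.
have E (h : 'M[R]_(2 + l.-1)) : (h *m c) (@inord l.-1.+1 i) 0 =
    \sum_j h (@inord l.-1.+1 i) j * c j 0 by rewrite mxE.
under eq_fun do rewrite E; rewrite ?E.
apply: cvg_big => [|j _]; first exact: add_continuous.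
exact: (cvgM (@coord_continuous _ _ _ (@inord l.-1.+1 i) j g) (cvg_cst _)).
Qed.

(** With p = g e_1 and v = g f, this is u v_t - t v_u: the velocity at which
    the projection to the (u, t) plane turns around the origin. *)
Definition turn f g : R :=
  crd (g *m bv 0) 0 * crd (g *m f) 1 - crd (g *m bv 0) 1 * crd (g *m f) 0.

(** Let a and b be the scalar products of v with itself and with p in the
    (u, t) plane.  The vector w = a p - b v has norm a^2, while its (u, t) part
    has square length a * turn^2, and norms are bounded by that length: if turn
    vanishes, so does a.  Then the null vector v is 0, against the isometry
    and f_t = -1. *)
Lemma turn_neq0 f g : SO R 2 l.-1 g -> adsform f f = 0 -> crd f 0 = 0 ->
  crd f 1 = -1 -> turn f g != 0.
Proof.
move=> gS ff f0 f1; apply/eqP; rewrite /turn.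
have pp : adsform (g *m bv 0) (g *m bv 0) = 1.
  by rewrite SO_isometry// adsform_b// crdb.
have pv : adsform (g *m bv 0) (g *m f) = 0.
  by rewrite SO_isometry// adsform_b.
have vv : adsform (g *m f) (g *m f) = 0 by rewrite SO_isometry.
have qv : adsform (g *m bv 1) (g *m f) = -1.
  by rewrite SO_isometry// adsform_b.
move: (g *m bv 0) (g *m f) (g *m bv 1) pp pv vv qv => p v q pp pv vv qv D0.
have space_ge0 (w : 'cV[R]_(2 + l.-1)) :
    adsform w w <= crd w 0 ^+ 2 + crd w 1 ^+ 2.
  rewrite adsformE//.
  have : 0 <= \sum_(4 <= k < l.+1) crd w k * crd w k.
    by apply: sumr_ge0 => k _; rewrite -expr2 sqr_ge0.
  have := sqr_ge0 (crd w 2); have := sqr_ge0 (crd w 3); rewrite !expr2; lra.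
pose a := crd v 0 ^+ 2 + crd v 1 ^+ 2.
pose b := crd p 0 * crd v 0 + crd p 1 * crd v 1.
have := space_ge0 (a *: p - b *: v).
rewrite -scaleN1r !(adsformDl, adsformDr, adsformZl, adsformZr).
rewrite (adsformC v)// pp pv vv !(crdD, crdZ).
have -> : (a * crd p 0 + -1 * (b * crd v 0)) ^+ 2
    + (a * crd p 1 + -1 * (b * crd v 1)) ^+ 2
    = a * (crd p 0 * crd v 1 - crd p 1 * crd v 0) ^+ 2.
  by rewrite /a /b; ring.
rewrite D0 => a2.
have a0 : a = 0.
  apply/eqP; rewrite -sqrf_eq0; apply/eqP/le_anti; rewrite sqr_ge0 andbT.
  by move: a2; lra.
have [v0 v1] : crd v 0 = 0 /\ crd v 1 = 0.
  have := sqr_ge0 (crd v 0); have := sqr_ge0 (crd v 1); move: a0; rewrite /a.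
  move=> a0 h1 h0; split; apply/eqP; rewrite -sqrf_eq0; apply/eqP; lra.
have S0 : 0 <= \sum_(4 <= k < l.+1) crd v k * crd v k.
  by apply: sumr_ge0 => k _; rewrite -expr2 sqr_ge0.
have := vv; rewrite adsformE// v0 v1.
have := sqr_ge0 (crd v 2); have := sqr_ge0 (crd v 3); rewrite !expr2 => h3 h2 h.
have v2 : crd v 2 = 0 by apply/eqP; rewrite -sqrf_eq0 expr2; apply/eqP; lra.
have v3 : crd v 3 = 0 by apply/eqP; rewrite -sqrf_eq0 expr2; apply/eqP; lra.
have S00 : \sum_(4 <= k < l.+1) crd v k * crd v k = 0 by lra.
move: qv; rewrite adsformE// v0 v1 v2 v3 big1_seq; first by lra.
move=> k /andP[_ kl]; move/eqP: S00; rewrite psumr_eq0; last first.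
  by move=> i _; rewrite -expr2 sqr_ge0.
by move=> /allP/(_ k kl)/=; rewrite -expr2 sqrf_eq0 => /eqP ->; rewrite mulr0.
Qed.

(** The image of the connected group G under turn is an interval that
    contains -1, the value at the identity, and does not contain 0. *)
Lemma future_turn f g : groupG R l g -> adsform f f = 0 -> crd f 0 = 0 ->
  crd f 1 = -1 -> turn f g < 0.
Proof.
move=> gG ff f0 f1.
have SO1 : SO R 2 l.-1 1%:M.
  by split; rewrite ?det1// trmx1 mul1mx mulmx1.
have cturn : continuous (turn f).
  have c v i := @crd_mul_continuous v i.
  by move=> h; exact: (cvgB (cvgM (c (bv 0) 0%N h) (c f 1%N h))
                            (cvgM (c (bv 0) 1%N h) (c f 0%N h))).
have : connected (turn f @` groupG R l).
  apply: connected_continuous_connected; first exact: component_connected.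
  exact: continuous_subspaceT.
move=> /connected_intervalP itv; rewrite ltNge; apply/negP => g0.
have [h hG h0] : (turn f @` groupG R l) 0.
  apply: (itv (turn f 1%:M) (turn f g)).
  - by exists 1%:M => //; exact: connected_component_refl.
  - by exists g.
  - rewrite g0 andbT /turn !mul1mx f0 f1 !crdb//=; lra.
have /eqP := h0; apply/negP; apply: turn_neq0 => //.
exact: connected_component_sub hG.
Qed.

End LightlikeGeodesics.

(** * Interior points, exterior points and the horizon *)

Section BlackHole.
Context {R : realType} {l : nat} (hl : (3 <= l)%N).
Implicit Types (p q f : 'cV[R]_(2 + l.-1)).
Local Notation bv := (bvec R l).

Let lt4 i : (i < 4)%N -> (i < 2 + l.-1)%N.
Proof. by move: hl; lia. Qed.

Let crdb i j : (i < 4)%N -> (j < 4)%N -> crd (bv i) j = (j == i)%:R.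
Proof. by move=> i4 j4; rewrite crd_bvec ?lt4. Qed.

(** The circle z = x = y = 0, the throat of the hyperboloid, parametrised by
    the (u, t) plane. *)
Definition waist (c d : R) : 'cV[R]_(2 + l.-1) := c *: bv 0 + d *: bv 1.

Lemma crd_waist c d i : (i < l.+1)%N ->
  crd (waist c d) i = c * (i == 0%N)%:R + d * (i == 1%N)%:R.
Proof.
by move=> il; rewrite crdD !crdZ !crd_bvec//; move: hl; lia.
Qed.

Lemma adsform_waist c d p : adsform (waist c d) p = c * crd p 0 + d * crd p 1.
Proof.
have lt4' k : (k < 4)%N -> (k < l.+1)%N by move: hl; lia.
rewrite adsformE// !crd_waist ?lt4'//= big_nat big1; first by ring.
move=> j jl; rewrite crd_waist; last by lia.
have [-> ->] : j == 0%N = false /\ j == 1%N = false by lia.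
by rewrite !mulr0 addr0 mul0r.
Qed.

Lemma null_waist c d : Tm (waist c d) = d /\ Tp (waist c d) = d.
Proof.
have lt4' k : (k < 4)%N -> (k < l.+1)%N by move: hl; lia.
by rewrite /Tm /Tp !crd_waist ?lt4'//=; split; ring.
Qed.

Lemma AdS_waist c d : c ^+ 2 + d ^+ 2 = 1 -> AdS R l (waist c d).
Proof.
have lt4' k : (k < 4)%N -> (k < l.+1)%N by move: hl; lia.
move=> cd; apply/AdSE => //; rewrite adsform_waist !crd_waist ?lt4'//= -[RHS]cd.
ring.
Qed.

Lemma AdS_null_line p v s : AdS R l p -> adsform p v = 0 -> adsform v v = 0 ->
  AdS R l (p + s *: v).
Proof.
move=> /(AdSE _ hl) pp pv vv; apply/AdSE => //.
rewrite !(adsformDl, adsformDr, adsformZl, adsformZr) (adsformC v)//.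
by rewrite pp pv vv; ring.
Qed.

(** The future null vectors v at such a point have v_t < 0, so that
    Tm v + Tp v < 0 whereas Tm and Tp are both equal to d > 0 at the point. *)
Lemma waist_BH c d : 0 < c -> 0 < d -> c ^+ 2 + d ^+ 2 = 1 ->
  BH R l (waist c d).
Proof.
have lt4' k : (k < 4)%N -> (k < l.+1)%N by move: hl; lia.
move=> c0 d0 cd; split; first exact: AdS_waist.
move=> gamma /(geodesicP hl)[g [f [gG gp [ff f0 f1] gammaE]]].
have gS : SO R 2 l.-1 g by exact: connected_component_sub gG.
have := future_turn hl gG ff f0 f1; rewrite /turn gp.
set v := g *m f; rewrite !crd_waist ?lt4'//= => turn0.
have pv : adsform (waist c d) v = 0.
  rewrite -gp SO_isometry// adsformC// adsformE// !crdb//= f0 big_nat big1.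
    ring.
  move=> j jl; rewrite crd_bvec; [|move: hl; lia..].
  by rewrite (_ : j == 0%N = false) ?mulr0//; lia.
have vv : adsform v v = 0 by rewrite SO_isometry.
have v1 : crd v 1 < 0.
  have cdv : c * (c * crd v 1 - d * crd v 0) < 0.
    by rewrite pmulr_rlt0//; move: turn0; lra.
  have -> : crd v 1 = (c ^+ 2 + d ^+ 2) * crd v 1 by rewrite cd mul1r.
  move: pv; rewrite adsform_waist => pv.
  have -> : (c ^+ 2 + d ^+ 2) * crd v 1 =
    c * (c * crd v 1 - d * crd v 0) + d * (c * crd v 0 + d * crd v 1) by ring.
  by rewrite pv mulr0 addr0.
have [Tm0 Tp0] := null_waist c d.
have onAdS s : AdS R l (waist c d + s *: v).
  by apply: AdS_null_line => //; exact: AdS_waist.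
have hit x : x < 0 -> 0 <= - d / x /\ d + (- d / x) * x = 0.
  move=> x0; have x0' : x != 0 by lra.
  split; last by rewrite divfK// subrr.
  by rewrite mulNr -mulrN -invrN divr_ge0//; lra.
have [Tmv|Tmv] := ltP (Tm v) 0.
  have [s0 e] := hit _ Tmv; exists (- d / Tm v) => //.
  rewrite gammaE singularityE//; split; first exact: onAdS.
  by left; rewrite TmD TmZ Tm0.
have Tpv : Tp v < 0 by move: Tmv v1; rewrite /Tm /Tp; lra.
have [s0 e] := hit _ Tpv; exists (- d / Tp v) => //.
rewrite gammaE singularityE//; split; first exact: onAdS.
by right; rewrite TpD TpZ Tp0.
Qed.

Definition rotation (x : R) : 'M[R]_(2 + l.-1) :=
  block_mx (\matrix_(i < 2, j < 2)
    (if i == j then cos x else if i == 0 then - sin x else sin x)) 0 0 1%:M.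

Lemma rotation_SO x : SO R 2 l.-1 (rotation x).
Proof.
split.
  rewrite /rotation det_ublock det1 mulr1 (expand_det_row _ ord0).
  rewrite !big_ord_recl big_ord0 addr0 /cofactor !det_mx11 !mxE /=.
  rewrite -[RHS](cos2Dsin2 x) !expr2; ring.
rewrite /rotation /eta_mx tr_block_mx !mulmx_block !trmx0 trmx1.
rewrite !(mulmx0, mul0mx, addr0, add0r, mul1mx, mulmx1); congr block_mx.
apply/matrixP => i j; rewrite mulmxN mulmx1 mulNmx !mxE.
rewrite !big_ord_recl big_ord0 !mxE.
have cs := cos2Dsin2 x; rewrite !expr2 in cs.
by case: i => [[|[|//]] ?]; case: j => [[|[|//]] ?];
  rewrite /= ?mulr1n ?mulr0n; lra.
Qed.

Lemma rotation0 : rotation 0 = 1%:M.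
Proof.
rewrite /rotation cos0 sin0 oppr0 scalar_mx_block; congr block_mx.
by apply/matrixP => i j; rewrite !mxE; case: eqP => //; case: eqP.
Qed.

Lemma rotation_continuous : continuous rotation.
Proof.
move=> x; have FF : Filter (nbhs x) by exact: nbhs_filter.
apply: mx_cvg_coord => i j.
case: (split_ordP i) => a ->; case: (split_ordP j) => b ->; rewrite /rotation.
- under eq_fun do rewrite block_mxEul mxE.
  rewrite block_mxEul mxE; case: (a == b); first exact: continuous_cos.
  by case: (a == 0); [apply: cvgN|]; exact: continuous_sin.
- under eq_fun do rewrite block_mxEur mxE.
  by rewrite block_mxEur mxE; exact: cvg_cst.
- under eq_fun do rewrite block_mxEdl mxE.
  by rewrite block_mxEdl mxE; exact: cvg_cst.
- under eq_fun do rewrite block_mxEdr mxE.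
  by rewrite block_mxEdr mxE; exact: cvg_cst.
Qed.

(** Rotations of the (u, t) plane form a connected set through the identity. *)
Lemma rotation_G x : groupG R l (rotation x).
Proof.
have C : connected (rotation @` setT).
  apply: connected_continuous_connected.
    by apply/connected_intervalP.
  by apply: continuous_subspaceT; exact: rotation_continuous.
have sub : rotation @` setT `<=` SO R 2 l.-1.
  by move=> _ [y _ <-]; exact: rotation_SO.
have one : (rotation @` setT) 1%:M by exists 0 => //; exact: rotation0.
by apply: (connected_component_max one sub C); exists x.
Qed.

Lemma crd_rotation x p i : (i < l.+1)%N -> crd (rotation x *m p) i =
  if i == 0%N then cos x * crd p 0 - sin x * crd p 1
  else if i == 1%N then sin x * crd p 0 + cos x * crd p 1 else crd p i.
Proof.
move=> il; have il' : (i < 2 + l.-1)%N by move: hl; lia.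
have -> : crd (rotation x *m p) i = (rotation x *m p) (Ordinal il') 0.
  by rewrite /crd; congr (_ _ 0); apply: val_inj; rewrite /= inordK.
rewrite -{1}[p]vsubmxK /rotation mul_block_col !mul0mx addr0 add0r mul1mx.
case: (split_ordP (Ordinal il')) => a iE; rewrite iE.
  rewrite col_mxEu mxE !big_ord_recl big_ord0 addr0 !mxE !lshift_inord /=.
  have -> : i = a by rewrite -[i]/(val (Ordinal il')) iE.
  by case: a {iE} => [[|[|//]] ?] /=; rewrite ?mulNr.
rewrite col_mxEd mxE rshift_inord.
have -> : i = (2 + a)%N by rewrite -[i]/(val (Ordinal il')) iE.
by [].
Qed.

Lemma rotation_quarter : rotation (pi / 2) *m bv 0 = bv 1 /\
  rotation (pi / 2) *m (bv 2 - bv 1) = bv 0 + bv 2.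
Proof.
split; apply: crd_inj => i il'; have il : (i < l.+1)%N by move: hl il'; lia.
  rewrite crd_rotation// sin_pihalf cos_pihalf !crd_bvec// ?lt4//.
  case: i il il' => [|[|i]] _ _ //=; ring.
rewrite crd_rotation// sin_pihalf cos_pihalf !(crdD, crdN).
rewrite !crd_bvec// ?lt4//; case: i il il' => [|[|i]] _ _ //=; ring.
Qed.

(** The quarter turn carries e_1 to e_2 and the initial null direction to
    e_1 + e_3, along which t = 1 and y = 0 are constant. *)
Lemma waist01_notin_BH : ~ BH R l (waist 0 1).
Proof.
have [r0 r1] := rotation_quarter.
move=> [_ /(_ (fun s => waist 0 1 + s *: (bv 0 + bv 2)))].
have w01 : waist 0 1 = bv 1 by rewrite /waist scale0r scale1r add0r.
case.
  have KH1 : KH R l 1%:M.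
    by exists 1%:M; rewrite ?scalar_mx_block//=; rewrite det1 trmx1 mulmx1.
  exists (rotation (pi / 2)), 1%:M; split => //.
  - exact: rotation_G.
  - by rewrite proj_AdSE r0 w01.
  - by apply/funext => s; rewrite geodesicE// mul1mx r0 r1 w01.
move=> s _; rewrite singularityE// => -[_].
have [Tm1 Tp1] := null_waist 0 1.
rewrite TmD TpD TmZ TpZ Tm1 Tp1 /Tm /Tp !crdD !crdb//=.
by case; lra.
Qed.

(** The point is the limit of (sin s, cos s, 0, ..., 0) for s > 0. *)
Lemma waist01_closure :
  closure (BH R l : set (subspace (AdS R l))) (waist 0 1).
Proof.
rewrite closure_subspaceW; last by move=> p [].
split; last by apply: AdS_waist; rewrite expr0n expr1n add0r.
pose f (s : R) := waist (sin s) (cos s).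
have -> : waist 0 1 = f 0 by rewrite /f sin0 cos0.
apply: closed_at_right; first exact: closed_closure.
  move=> s; apply: cvgD; apply: cvgZr_tmp.
    exact: continuous_sin.
  exact: continuous_cos.
near=> s; apply: subset_closure; apply: waist_BH.
- apply: sin_gt0_pihalf; apply/andP; split; near: s.
    exact: nbhs_right_gt.
  by apply: nbhs_right_lt; rewrite divr_gt0// pi_gt0.
- apply: cos_gt0_pihalf; apply/andP; split.
    apply: (@lt_trans _ _ 0); first by rewrite oppr_lt0 divr_gt0// pi_gt0.
    by near: s; exact: nbhs_right_gt.
  by near: s; apply: nbhs_right_lt; rewrite divr_gt0// pi_gt0.
- by rewrite addrC cos2Dsin2.
Unshelve. all: by end_near. Qed.

End BlackHole.

Theorem theorem1p2 (R : realType) (l : nat) (hl : (3 <= l)%N) :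
  [/\ causal_solvable_symmetric_black_hole R l,
      (event_horizon R l !=set0)%classic &
      finite_set (closed_orbits R l)].
Proof.
have notBH := waist01_notin_BH (R := R) hl.
split; [split| |exact: closed_orbits_finite].
- exists (waist 1 0); rewrite singularityE//; split.
    by apply: (AdS_waist hl); rewrite expr1n expr0n addr0.
  by left; have [] := null_waist (R := R) hl 1 0.
- split.
    move=> p pS; split; first by move: pS; rewrite singularityE// => -[].
    move=> gamma /(geodesicP hl)[g [f [_ _ _ gammaE]]].
    by exists 0 => //; rewrite gammaE scale0r addr0.
  (* Any interior point of the arc serves; this one is rational. *)
  pose c : R := 3 / 5; pose d : R := 4 / 5.
  have /[swap] /[apply] : BH R l (waist c d).
    by apply: waist_BH => //; rewrite /c /d; lra.
  rewrite singularityE// => -[_]; have [-> ->] := null_waist hl c d.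
  by rewrite /d; case; lra.
- split; first by move=> p [].
  move=> sub; apply/notBH/sub.
  by apply: (AdS_waist hl); rewrite expr1n expr0n add0r.
- exists (waist 0 1); split; first exact: waist01_closure.
  by move=> /interior_subset.
Qed.
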